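(* There is an absolute constant $c>0$ such that the following holds. Suppose that for some $\delta>0$ and $D>0$, $$\sup_{z\in\mathcal L}\inf_{w\in\Psi_j}\bigl\|\widetilde C_j(z,\cdot)-w\bigr\|_{L_2(\mu_j\otimes\mathbb P_M)}\le\delta,\qquad \mathtt{VC}(\Psi_j)\le D,\qquad 0\le j\le J-1.$$ Then for $j=0,\dots,J-1$, $$\Bigl\|\sup_{z\in\mathcal L}\bigl|v_{j,M}(z,\cdot)-v_j^\ast(z,\cdot)\bigr|\Bigr\|_{L_2(\mu_j\otimes\mathbb P_M)}\le\left(\sqrt{cW^4\,\frac{1+\log M}{M}\,D}+\sqrt2\,\delta\right)\frac{|\mathcal L|^{J-j+1}-|\mathcal L|}{|\mathcal L|-1},$$ where the fraction is read as $J-j$ if $|\mathcal L|=1$.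
   Context: Control problem. $X=(X_j)_{0\le j\le J}$ is a Markov process with values in $\mathcal X$, adapted to a filtration $(\mathcal F_j)$; $\mu_j$ is the law of $X_j$; $X^{j,x}$ denotes $X$ conditioned on $X_j=x$. $\mathcal K$ (actions) and $\mathcal L$ (controls) are finite sets; $K_j(y,x)\subset\mathcal K$ is the set of admissible actions; $H_j(a,y,x)$ is a measurable cash-flow; $\varphi_{j+1}:\mathcal K\times\mathcal L\to\mathcal L$ is the control update. An admissible strategy from time $j$, control $y$, state $x$ is an adapted $\mathcal K$-valued process $\mathbf A=(A_\ell)_{\ell=j}^J$ with $A_\ell\in K_\ell(Y_\ell,X^{j,x}_\ell)$, where $Y_j=y$, $Y_{\ell+1}=\varphi_{\ell+1}(A_\ell,Y_\ell)$. The value function is $v_j^\ast(y,x)=\sup_{\mathbf A}\mathsf E\bigl[\sum_{\ell=j}^JH_\ell(A_\ell,Y_\ell,X^{j,x}_\ell)\bigr]$, which satisfies $v^\ast_{J+1}\equiv0$ and $v_j^\ast(y,x)=\sup_{a\in K_j(y,x)}\bigl(H_j(a,y,x)+\mathsf E[v^\ast_{j+1}(\varphi_{j+1}(a,y),X^{j,x}_{j+1})]\bigr)$. Assume $|H_j(a,y,x)|\le C_H$ for all $j,a,y,x$, and put $W:=JC_H$. $T_W$ is truncation at level $W$: $T_Wf=f$ where $|f|\le W$ and $T_Wf=W\,\mathrm{sign}(f)$ otherwise. Estimates. $\Psi_j$, $j=0,\dots,J$, are spaces (not necessarily linear) of functions on $\mathcal X$; $\mathtt{VC}(\Psi_j)$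 is the Vapnik–Chervonenkis dimension of $\Psi_j$ (i.e. of the class of subgraphs of functions in $\Psi_j$). For each $j$, $\mathcal D_{M,j}=\{(X^{(m)}_j,X^{(m)}_{j+1}):m=1,\dots,M\}$ is a sample from the joint law of $(X_j,X_{j+1})$; the samples $\mathcal D_{M,j}$ are independent for different $j$; $\mathbb P_M$ is the law of all the samples; $\mathcal G_{j,M}$ is the $\sigma$-algebra generated by the samples used for times $\ge j$. The empirical projection is $\mathcal P_{j,M}[g](z,\cdot)\in\arg\inf_{\psi\in\Psi_j}\sum_{m=1}^M|g(z,X^{(m)}_{j+1})-\psi(X^{(m)}_j)|^2$. Set $v_{J,M}(y,x)=\sup_{a\in K_J(y,x)}H_J(a,y,x)$ and, for $j<J$, $v_{j,M}(y,x)=\sup_{a\in K_j(y,x)}\bigl(H_j(a,y,x)+T_W\mathcal P_{j,M}[v_{j+1,M}](\varphi_{j+1}(a,y),x)\bigr)$. For $j<J$: $\widetilde C_j(z,x):=\mathsf E_{\mathcal G_{j+1,M}}[v_{j+1,M}(z,X^{j,x}_{j+1})]$ (conditional expectation given $\mathcal G_{j+1,M}$, the trajectory $X$ being independent of the samples). The constant $c$ is the one in the following known regression estimate (Györfi et al., Theorem 11.5), used by the paper: for all $g$ with $\|g\|_\infty\le W$, $0\le j\le J-1$, $z\in\mathcal L$, $\mathsf E\bigl[\|T_W\mathcal P_{j,M}[g](z,\cdot)-\mathsf E[g(z,X^{j,\cdot}_{j+1})]\|^2_{L_2(\mu_j)}\bigr]\le cW^4\frac{1+\log M}{M}\mathtt{VC}(\Psi_j)+2\inf_{w\in\Psi_j}\|\mathsf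 E[g(z,X^{j,\cdot}_{j+1})]-w\|^2_{L_2(\mu_j)}$.
   Formalization: The formal statement adds the assumption W ≥ 1: with an absolute c and the factor W^4 the claim fails for small W (J=1, M=1, constant functions, a fair-coin payoff ±W: the left side is W, the right side is √c·W²+√2·δ with δ arbitrarily small). *)

(* Defs.v *)
From HB Require Import structures.
From mathcomp Require Export all_boot all_order all_algebra.
From mathcomp Require Export all_classical all_reals all_analysis.

Set Implicit Arguments.
Unset Strict Implicit.
Unset Printing Implicit Defensive.

Import Order.TTheory GRing.Theory Num.Theory.
Import numFieldNormedType.Exports.

Local Open Scope classical_set_scope.
Local Open Scope ring_scope.

Section vc_dimension.
Context {R : realType} {T : Type}.

(* A shattered family of points is automatically injective. *)
Definition shatters (U : Type) (C : set (set U)) (n : nat) (p : 'I_n -> U) :=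
  forall B : {set 'I_n}, exists2 A, C A & forall i, A (p i) <-> i \in B.

Definition subgraph (f : T -> R) : set (T * R) := [set q | q.2 <= f q.1].

Definition VC (Psi : set (T -> R)) : \bar R :=
  ereal_sup [set n%:R%:E | n in
    [set n | exists p : 'I_n -> T * R, shatters (subgraph @` Psi) p]].

End vc_dimension.

Section truncation.
Context {R : realType}.

Definition trunc (W f : R) : R := if `|f| <= W then f else W * Num.sg f.

(* n + n^2 + ... + n^k *)
Definition geom_factor (n k : nat) : R :=
  if n == 1%N then k%:R else (n%:R ^+ k.+1 - n%:R) / (n%:R - 1).

End truncation.

Section markov_process.
Local Open Scope ereal_scope.
Context {R : realType} {dO d : measure_display}
  {Omega : measurableType dO} {T : measurableType d}.
Variables (J : nat) (F : nat -> set (set Omega))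
  (X : nat -> {mfun Omega >-> T}) (P : probability Omega R)
  (Q : nat -> R.-pker T ~> Omega).

Definition is_filtration :=
  [/\ forall j, (j <= J)%N -> sigma_algebra setT (F j),
      forall j, (j <= J)%N -> F j `<=` measurable &
      forall i j, (i <= j <= J)%N -> F i `<=` F j].

Definition adapted :=
  forall j B, (j <= J)%N -> measurable B -> F j (X j @^-1` B).

(* Markov property on times j, ..., J under the law nu, the transition from
   time l to time l + 1 at x being the law of X_{l+1} under Q l x. *)
Definition markov_from (j : nat) (nu : set Omega -> \bar R) :=
  forall l A B, (j <= l < J)%N -> F l A -> measurable B ->
    nu (A `&` X l.+1 @^-1` B)
    = \int[nu]_(w in A) Q l (X l w) (X l.+1 @^-1` B).

(* Q j x is the law of X^{j,x}: a regular version of P( . | X_j = x) which,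
   for every x (and not only almost every one), starts from x at time j and has
   the Markov property from time j on. *)
Definition is_conditional_law (j : nat) :=
  [/\ forall A B, measurable A -> measurable B ->
        P (A `&` X j @^-1` B) = \int[distribution P (X j)]_(x in B) Q j x A,
      forall x B, measurable B -> Q j x (X j @^-1` B) = \d_x B &
      forall x, markov_from j (Q j x)].

Definition markov_process :=
  [/\ is_filtration, adapted, markov_from 0 P &
      forall j, (j <= J)%N -> is_conditional_law j].

End markov_process.

Section control.
Context {R : realType} {dO d : measure_display}
  {Omega : measurableType dO} {T : measurableType d} {KK LL : finType}.
Variables (J : nat) (F : nat -> set (set Omega))
  (X : nat -> {mfun Omega >-> T}) (Q : nat -> R.-pker T ~> Omega)
  (K : nat -> LL -> T -> {set KK}) (H : nat -> KK -> LL -> T -> R)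
  (phi : nat -> KK -> LL -> LL).

(* control A j y w k = Y_{j+k}, for the control started from Y_j = y. *)
Fixpoint control (A : nat -> Omega -> KK) (j : nat) (y : LL) (w : Omega)
    (k : nat) : LL :=
  if k is k'.+1 then phi (j + k)%N (A (j + k')%N w) (control A j y w k')
  else y.

Definition admissible (j : nat) (y : LL) (A : nat -> Omega -> KK) :=
  forall l, (j <= l <= J)%N ->
    (forall a, F l (A l @^-1` [set a])) /\
    (forall w, A l w \in K l (control A j y w (l - j)) (X l w)).

Definition reward (j : nat) (y : LL) (A : nat -> Omega -> KK) (w : Omega) : R :=
  \sum_(j <= l < J.+1) H l (A l w) (control A j y w (l - j)) (X l w).

Definition value (j : nat) (y : LL) (x : T) : R :=
  sup [set \int[Q j x]_w reward j y A w | A in admissible j y].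

End control.

Section estimation.
Context {R : realType} {dO d : measure_display}
  {Omega : measurableType dO} {T : measurableType d} {KK LL : finType}.
Variables (J M : nat).

(* s : samples is the collection of all samples: tnth (tnth s j) m is the
   pair (X_j^(m), X_{j+1}^(m)). *)
Definition samples := J.-tuple (M.-tuple (T * T)).

Definition pair_law (P : probability Omega R) (X : nat -> {mfun Omega >-> T})
    (j : nat) (B : set (T * T)) : \bar R :=
  P ((fun w => (X j w, X j.+1 w)) @^-1` B).

(* PM is the product law: all pairs are independent, and those of index j are
   distributed as (X_j, X_{j+1}). *)
Definition is_samples_law (P : probability Omega R)
    (X : nat -> {mfun Omega >-> T}) (PM : probability samples R) :=
  forall B : 'I_J -> 'I_M -> set (T * T), (forall j m, measurable (B j m)) ->
    PM [set s : samples | forall j m, B j m (tnth (tnth s j) m)]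
    = (\prod_(j < J) \prod_(m < M) pair_law P X j (B j m))%E.

Definition G (j : nat) : set (set samples) :=
  <<s [set A | exists (i : 'I_J) (m : 'I_M) (B : set (T * T)),
    [/\ (j <= i)%N, measurable B &
        A = [set s : samples | B (tnth (tnth s i) m)]]] >>.

Definition G_measurable (j : nat) (f : T -> samples -> R) :=
  forall U : set R, measurable U ->
    <<s [set B `*` A | B in measurable & A in G j] >>
      [set xs : T * samples | U (f xs.1 xs.2)].

Definition is_least_squares (Psi : set (T -> R)) (D : M.-tuple (T * T))
    (g h : T -> R) :=
  Psi h /\ forall psi, Psi psi ->
    \sum_(m < M) `|g (tnth D m).2 - h (tnth D m).1| ^+ 2
    <= \sum_(m < M) `|g (tnth D m).2 - psi (tnth D m).1| ^+ 2.

Variables (X : nat -> {mfun Omega >-> T}) (Q : nat -> R.-pker T ~> Omega)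
  (K : nat -> LL -> T -> {set KK}) (H : nat -> KK -> LL -> T -> R)
  (phi : nat -> KK -> LL -> LL) (W : R) (C : nat -> LL -> T -> samples -> R).

(* C j z x s stands for P_{j,M}[v_{j+1,M}](z, x). *)
Definition vM (j : nat) (y : LL) (x : T) (s : samples) : R :=
  if (j < J)%N then
    sup [set H j a y x + trunc W (C j (phi j.+1 a y) x s)
        | a in [set` K j y x]]
  else sup [set H j a y x | a in [set` K j y x]].

Definition is_empirical_projection (Psi : nat -> set (T -> R)) :=
  forall (j : 'I_J) z,
    (forall s, is_least_squares (Psi j) (tnth s j)
                 (fun x => vM j.+1 z x s) (fun x => C j z x s)) /\
    G_measurable j (C j z).

(* As X and the samples are independent, conditioning on G_{j+1,M} amounts to
   integrating over the trajectory with the samples frozen. *)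
Definition Ctilde (j : nat) (z : LL) (x : T) (s : samples) : R :=
  \int[Q j x]_w vM j.+1 z (X j.+1 w) s.

End estimation.

(* Main.v *)
(** A single estimate drives the proof: for each control the truncated empirical
    projection approximates the conditional expectation it targets, up to a
    statistical error and sqrt 2 times the bias.  Bellman's equation, for v^*
    and for v_{.,M}, then propagates the error at time j+1 to time j through
    conditional expectations, which are L_2-contractions by Jensen; hence
    e_j <= |L| eps + e_{j+1} with e_J = 0, and |L| (J - j) is below the sum
    |L| + ... + |L|^(J-j).

    The functions v_{j+1,M} are bounded by L = 2W only, not by W.  The
    regression estimate is therefore proved with truncation at L and used
    through |T_W f - T_W m| <= |T_L f - m|; truncating the target is harmless
    since the true continuation values are bounded by W.

    For the regression estimate, twice the empirical excess risk is compared
    with the risk on an independent ghost sample, and the difference is averaged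
    over all exchanges of sample points with ghost points.  For a fixed double
    sample only the estimators computed from the exchanged samples occur: a
    finite subfamily of Psi_j, so that no measurability of a supremum over Psi_j
    is needed.  Rounded to M levels on the 2M points it takes at most
    (2M^2+1)^VC values (Sauer-Shelah), and each rounded function has an
    exponential moment at most one, because the excess risk has variance bounded
    by a multiple of the squared distance to the target. *)
From HB Require Import structures.
Require Import Defs.
From mathcomp Require Import ring lra measurable_realfun.

Set Implicit Arguments.
Unset Strict Implicit.
Unset Printing Implicit Defensive.

Import Order.TTheory GRing.Theory Num.Theory.
Import numFieldNormedType.Exports.

(** * Families of finite sets *)

Section shattering.
Import boot.fintype boot.finset.
Local Open Scope nat_scope.
Variable V : finType.
Implicit Types (F : {set {set V}}) (S : {set V}).

(** The target of the regression at time j is itself random, being computed from the later samples.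
    Conditioning on them is expressed by invariance: the target does not change when pairs of index
    j are exchanged, so the pairs of index j in a second copy of all the samples can serve as ghost
    points.

    A uniform bound on the plain excess risk would only give the rate M^(-1/2). On the ghost side,
    twice the excess risk minus the squared distance to the target still has the squared distance as
    its mean, while exchanging sample and ghost points leaves a negative drift that pays for the
    variance. This gives the rate (1 + log M) / M. The doubling is also the source of the factor 2
    before the squared bias, hence of sqrt 2 before delta.

    The value function is a supremum over adapted strategies, so Bellman's equation is itself to be
    proved. The backward recursion is compared with an arbitrary strategy by an exact identity, and
    is attained by a strategy built from measurably selected maximising actions. *)

Definition shattered F : {set {set V}} :=
  [set S : {set V} | [forall B : {set V}, (B \subset S) ==>
              [exists A in F, A :&: S == B]]].

Lemma shatteredP F S :
  reflect (forall B : {set V}, B \subset S -> exists2 A, A \in F & A :&: S = B)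
          (S \in shattered F).
Proof.
rewrite inE; apply: (iffP forallP) => h B.
  move=> BS; have /implyP /(_ BS) /existsP [A /andP[AF /eqP AS]] := h B.
  by exists A.
apply/implyP => /h[A AF AS]; apply/existsP; exists A.
by rewrite AF AS eqxx.
Qed.

Lemma sub_shattered F F' : F \subset F' -> shattered F \subset shattered F'.
Proof.
move=> /subsetP FF'; apply/subsetP => S /shatteredP h; apply/shatteredP => B.
by move=> /h[A AF AS]; exists A => //; exact: FF'.
Qed.

(* Pajor: the two halves of F cut out by a coordinate x shatter sets avoiding
   x, and F shatters x |: S as soon as both halves shatter S. *)
Lemma card_le_shattered F : #|F| <= #|shattered F|.
Proof.
have [k] := ubnP #|F|; elim: k F => // k IH F; rewrite ltnS => Fk.
have [F1|F2] := leqP #|F| 1.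
  have [->|[A AF]] := set_0Vmem F; first by rewrite cards0.
  apply: (leq_trans F1); rewrite card_gt0; apply/set0Pn; exists finset.set0.
  apply/shatteredP => B; rewrite subset0 => /eqP ->.
  by exists A; rewrite ?finset.setI0.
have /card_gt1P[A [B [AF BF AB]]] := F2.
have [x xAB] : exists x, (x \in A) != (x \in B).
  apply/existsP; apply/contraT; rewrite negb_exists => /forallP h.
  by move/eqP: AB; case; apply/setP => x; apply/eqP; have := h x; rewrite negbK.
pose F0 := [set C in F | x \notin C]; pose F1 := [set C in F | x \in C].
have FU : F0 :|: F1 = F.
  by apply/setP => C; rewrite !inE; case: (x \in C); rewrite ?andbT ?andbF ?orbF.
have dF : [disjoint F0 & F1].
  rewrite -setI_eq0; apply/eqP/setP => C; rewrite !inE.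
  by case: (x \in C); rewrite ?andbF.
have cF : #|F| = #|F0| + #|F1| by rewrite -FU cardsU disjoint_setI0// cards0 subn0.
have F0p : 0 < #|F0|.
  rewrite card_gt0; apply/set0Pn; case xA : (x \in A).
    by exists B; rewrite inE BF; move: xAB; rewrite xA; case: (x \in B).
  by exists A; rewrite inE AF xA.
have F1p : 0 < #|F1|.
  rewrite card_gt0; apply/set0Pn; case xA : (x \in A).
    by exists A; rewrite inE AF xA.
  by exists B; rewrite inE BF; move: xAB; rewrite xA; case: (x \in B).
have l0 : #|F0| <= #|shattered F0|.
  by apply: IH; rewrite (leq_trans _ Fk)// cF -addn1 leq_add2l.
have l1 : #|F1| <= #|shattered F1|.
  by apply: IH; rewrite (leq_trans _ Fk)// cF -add1n leq_add2r.
have x0 S : S \in shattered F0 -> x \notin S.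
  move=> /shatteredP /(_ S (subxx _)) [C]; rewrite inE => /andP[_ xC] CS.
  by apply: contra xC => xS; move: xS; rewrite -CS inE => /andP[].
have x1 S : S \in shattered F1 -> x \notin S.
  move=> /shatteredP /(_ finset.set0 (sub0set _)) [C].
  rewrite inE => /andP[_ xC] CS; apply/negP => xS.
  have : x \in C :&: S by rewrite inE xC xS.
  by rewrite CS inE.
rewrite cF; apply: (leq_trans (leq_add l0 l1)).
pose I := shattered F0 :&: shattered F1.
have cI : #|[set x |: S | S in I]| = #|I|.
  apply: card_in_imset => S S'; rewrite !in_setI => /andP[/x0 xS _] /andP[/x0 xS' _].
  by move=> e; rewrite -(setU1K xS) e setU1K.
have -> : #|shattered F0| + #|shattered F1|
    = #|(shattered F0 :|: shattered F1) :|: [set x |: S | S in I]|.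
  rewrite [in RHS]cardsU disjoint_setI0 ?cards0 ?subn0; last first.
    rewrite disjoint_sym disjoints_subset; apply/subsetP => S /imsetP[S' _ ->].
    rewrite in_setC in_setU negb_or; apply/andP; split; apply/negP.
      by move=> /x0; rewrite setU11.
    by move=> /x1; rewrite setU11.
  rewrite cI cardsU subnK//; apply: (leq_trans (subset_leq_card (subsetIl _ _))).
  exact: leq_addr.
apply: subset_leq_card; rewrite !subUset; apply/andP; split.
  by rewrite !sub_shattered// -FU ?subsetUl ?subsetUr.
apply/subsetP => T /imsetP[S]; rewrite in_setI => /andP[S0 S1] ->.
apply/shatteredP => C CS.
have CxS : C :\ x \subset S.
  apply/subsetP => y; rewrite !inE => /andP[yx yC].
  by have := subsetP CS y yC; rewrite !inE (negbTE yx).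
have xS := x0 _ S0.
case xC : (x \in C).
  move: S1 => /shatteredP /(_ _ CxS)[D]; rewrite inE => /andP[DF xD] DS.
  exists D => //; apply/setP => y; move/setP: DS => /(_ y); rewrite !inE.
  by have [->|] := eqVneq y x; rewrite ?xC ?xD.
move: S0 => /shatteredP /(_ _ CxS)[D]; rewrite inE => /andP[DF xD] DS.
exists D => //; apply/setP => y; move/setP: DS => /(_ y); rewrite !inE.
by have [->|] := eqVneq y x; rewrite ?xC ?(negbTE xD).
Qed.

(** Every set with at most d elements is the set of proper values of a map from ['I_d] to
    [option V]: list its elements and pad with [None]. *)
Lemma card_small_sets (d : nat) :
  #|[set S : {set V} | #|S| <= d]| <= #|V|.+1 ^ d.
Proof.
rewrite -card_option -[d in leqRHS]card_ord -card_ffun -cardsT.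
pose g (f : {ffun 'I_d -> option V}) := [set x | Some x \in codom f].
apply: leq_trans (leq_imset_card g [set: _]).
apply: subset_leq_card; apply/subsetP => S; rewrite inE => Sd.
apply/imsetP; exists [ffun i : 'I_d => nth None (map Some (enum S)) i] => //.
apply/setP => x; rewrite inE; apply/idP/codomP => [xS|[i]].
  have xS' : Some x \in map Some (enum S) by rewrite map_f ?mem_enum.
  have lt : index (Some x) (map Some (enum S)) < d.
    by rewrite (leq_trans _ Sd)// cardE -(size_map Some) index_mem.
  by exists (Ordinal lt); rewrite ffunE nth_index.
rewrite ffunE => e.
have : Some x \in map Some (enum S).
  rewrite e mem_nth// ltnNge; apply/negP => h.
  by move: e; rewrite nth_default.
by move=> /mapP[y yS [->]]; rewrite -mem_enum.
Qed.

Definition traces (U : Type) (p : V -> U) (C : set (set U)) : {set {set V}} :=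
  [set B : {set V} | `[< exists2 A, C A & forall i, A (p i) <-> i \in B >]].

(** An enumeration of a set of indices shattered by the traces is a family of points shattered by
    [C]; hence all shattered sets have at most d elements, and it remains to count small sets. *)
Lemma card_traces (U : Type) (p : V -> U) (C : set (set U)) (d : nat) :
  (forall k (q : 'I_k -> U), shatters C q -> k <= d) ->
  #|traces p C| <= #|V|.+1 ^ d.
Proof.
move=> Cd; apply: leq_trans (card_le_shattered _) _.
apply: leq_trans (card_small_sets d); apply: subset_leq_card.
apply/subsetP => S /shatteredP hS; rewrite inE.
apply: (Cd _ (p \o (fun i : 'I_#|S| => enum_val i))) => B.
have BS : [set enum_val i | i in B] \subset S.
  by apply/subsetP => _ /imsetP[i _ ->]; exact: enum_valP.
have [A] := hS _ BS; rewrite inE => /asboolP[D CD DA] AS.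
exists D => // i /=; split=> [/DA iA|iB].
  have : enum_val i \in [set enum_val i | i in B].
    by rewrite -AS inE iA enum_valP.
  by rewrite mem_imset//; exact: enum_val_inj.
apply/DA; have : enum_val i \in A :&: S by rewrite AS mem_imset//; exact: enum_val_inj.
by rewrite inE => /andP[].
Qed.

End shattering.

Local Open Scope classical_set_scope.
Local Open Scope ring_scope.

Lemma sqr_le_norm (R : realDomainType) (a c : R) :
  0 <= c -> (a ^+ 2 <= c ^+ 2) = (`|a| <= c).
Proof.
by move=> c0; rewrite -[a ^+ 2]real_normK ?num_real// ler_pXn2r ?nnegrE.
Qed.

(** * Truncation as a clamp *)

Section truncation_facts.
Context {R : realType}.
Implicit Types W L f y : R.

Lemma truncE W f : 0 <= W -> trunc W f = Num.max (- W) (Num.min W f).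
Proof.
move=> W0; rewrite /trunc; have [fW|fW] := leP `|f| W.
  by move: fW; rewrite ler_norml => /andP[Wf fW]; rewrite min_r// max_r.
have [f0|f0|f0] := ltgtP f 0.
- rewrite ltr0_sg// mulrN1; move: fW; rewrite ltr0_norm// => fW.
  by rewrite min_r ?max_l//; lra.
- rewrite gtr0_sg// mulr1; move: fW; rewrite gtr0_norm// => fW.
  by rewrite min_l ?max_r//; lra.
- by move: fW; rewrite f0 normr0; lra.
Qed.

Lemma trunc_id W f : `|f| <= W -> trunc W f = f.
Proof. by rewrite /trunc => ->. Qed.

Lemma norm_trunc W f : 0 <= W -> `|trunc W f| <= W.
Proof.
move=> W0; rewrite truncE// ler_norml; apply/andP; split.
  by rewrite le_max lexx.
by rewrite ge_max ge_min lexx /= andbT; lra.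
Qed.

Lemma trunc_lip W f y : 0 <= W -> `|trunc W f - trunc W y| <= `|f - y|.
Proof.
move=> W0; rewrite !truncE//.
wlog fy : f y / y <= f.
  by move=> h; have [/h//|/ltW/h] := leP y f; rewrite distrC [leRHS]distrC.
rewrite [leRHS]ger0_norm ?subr_ge0// ler_norml.
case: (leP W f) => ?; case: (leP W y) => ?; rewrite ?[Num.max _ W]max_r; try lra.
all: case: (leP (- W) f) => ?; case: (leP (- W) y) => ?; apply/andP; split; lra.
Qed.

Lemma trunc_ge W f : 0 <= W -> W <= f -> trunc W f = W.
Proof. by move=> W0 Wf; rewrite truncE// min_l// max_r//; lra. Qed.

Lemma trunc_le W f : 0 <= W -> f <= - W -> trunc W f = - W.
Proof. by move=> W0 Wf; rewrite truncE// min_r ?max_l//; lra. Qed.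

Lemma trunc_trunc W L f : 0 <= W -> W <= L -> trunc W (trunc L f) = trunc W f.
Proof.
move=> W0 WL; have L0 : 0 <= L by lra.
have [Lf|fL] := leP L f; first by rewrite (trunc_ge L0 Lf) !trunc_ge//; lra.
have [fL'|Lf] := leP f (- L); first by rewrite (trunc_le L0 fL') !trunc_le//; lra.
by rewrite (@trunc_id L)// ler_norml; apply/andP; split; lra.
Qed.

Lemma trunc_sqr_le L f y : `|y| <= L -> (trunc L f - y) ^+ 2 <= (f - y) ^+ 2.
Proof.
move=> yL; have L0 : 0 <= L by exact: le_trans yL.
rewrite -[leRHS]real_normK ?num_real// sqr_le_norm//.
by rewrite -{1}(trunc_id yL) trunc_lip.
Qed.

End truncation_facts.

(** * Exponential moments under exchange of sample and ghost points *)

Section finite_symmetrization.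
Context {R : realType}.

(** Squaring and inverting 1 - x/2 <= exp (-x/2) bounds exp x by (1 - x/2)^-2, and (1 + x + x^2) (1
    - x/2)^2 = 1 + x^2 (1 - 3x + x^2) / 4 is at least 1 in this range. *)
Lemma expR_quadratic (x : R) : `|x| <= 1 / 4 -> expR x <= 1 + x + x ^+ 2.
Proof.
rewrite ler_norml => /andP[x1 x2].
have h : 1 - x / 2 <= expR (- (x / 2)).
  by rewrite (le_trans _ (expR_ge1Dx _))//; lra.
have -> : x = - (- (x / 2)) + - (- (x / 2)) by field.
rewrite [in leLHS]expRD expRN.
set e := expR _ in h *.
have e0 : 0 < e by exact: expR_gt0.
rewrite -invfM -[leLHS]div1r ler_pdivrMr ?mulr_gt0//.
have : (1 - x / 2) * (1 - x / 2) <= e * e by apply: ler_pM; lra.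
nra.
Qed.

(* Of the two points indexed by [bool], [b] is in the sample and [~~ b] in the
   ghost sample; [y], [m], [u] are the responses, the regression function and the
   estimator.  On the ghost sample the excess risk and the squared distance to
   [m] have the same mean. *)
Definition dev (y m u : bool -> R) (b : bool) : R :=
  2 * ((u (~~ b) - y (~~ b)) ^+ 2 - (m (~~ b) - y (~~ b)) ^+ 2)
  - (u (~~ b) - m (~~ b)) ^+ 2
  - 2 * ((u b - y b) ^+ 2 - (m b - y b) ^+ 2).

(** By the quadratic bound on the exponential: the two deviations add up to -s, with s the sum of
    the two squared distances, and each has square at most 200 L^2 s. At the scale 400 L^2 the drift
    -s cancels the quadratic terms exactly. *)
Lemma dev_expR (L : R) (y m u : bool -> R) : 0 < L ->
  (forall b, `|y b| <= L) -> (forall b, `|m b| <= L) ->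
  (forall b, `|u b| <= L) ->
  expR (dev y m u true / (400 * L ^+ 2)) + expR (dev y m u false / (400 * L ^+ 2))
    <= 2.
Proof.
move=> L0 yL mL uL; set l := (400 * L ^+ 2)^-1.
have L2 : 0 < 400 * L ^+ 2 by have := exprn_gt0 2 L0; lra.
have l0 : 0 < l by rewrite invr_gt0.
have lL : 400 * L ^+ 2 * l = 1 by exact: mulfV (lt0r_neq0 L2).
pose s := (u true - m true) ^+ 2 + (u false - m false) ^+ 2.
have s0 : 0 <= s by rewrite addr_ge0// sqr_ge0.
have s8 : s <= 8 * L ^+ 2.
  have aux b : (u b - m b) ^+ 2 <= 4 * L ^+ 2.
    have := uL b; have := mL b; rewrite !ler_norml => /andP[? ?] /andP[? ?].
    have : (u b - m b) ^+ 2 <= (2 * L) ^+ 2.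
      by rewrite sqr_le_norm ?ler_norml; lra.
    by rewrite exprMn; lra.
  by have := aux true; have := aux false; rewrite /s; lra.
have sD : dev y m u true + dev y m u false = - s by rewrite /dev /s /=; ring.
have sq b : dev y m u b ^+ 2 <= 200 * L ^+ 2 * s.
  set p := 2 * (u (~~ b) + m (~~ b) - 2 * y (~~ b)) - (u (~~ b) - m (~~ b)).
  set q := 2 * (u b + m b - 2 * y b).
  have -> : dev y m u b = (u (~~ b) - m (~~ b)) * p - (u b - m b) * q.
    by rewrite /dev /p /q; ring.
  have pq c : `|u c| <= L /\ `|m c| <= L /\ `|y c| <= L by [].
  (* The modulus of [p] is at most 2 * 4 L + 2 L = 10 L; that of [q] is at most 8 L and gets the
     same bound. *)
  have p2 : p ^+ 2 <= 100 * L ^+ 2.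
    have := pq (~~ b); rewrite !ler_norml /p => -[/andP[? ?] [/andP[? ?] /andP[? ?]]].
    have -> : 100 * L ^+ 2 = (10 * L) ^+ 2 by ring.
    by rewrite sqr_le_norm ?ler_norml; lra.
  have q2 : q ^+ 2 <= 100 * L ^+ 2.
    have := pq b; rewrite !ler_norml /q => -[/andP[? ?] [/andP[? ?] /andP[? ?]]].
    have -> : 100 * L ^+ 2 = (10 * L) ^+ 2 by ring.
    by rewrite sqr_le_norm ?ler_norml; lra.
  have -> : s = (u (~~ b) - m (~~ b)) ^+ 2 + (u b - m b) ^+ 2.
    by rewrite /s; case: b {p q p2 q2} => /=; ring.
  set a := u (~~ b) - m (~~ b); set c := u b - m b.
  have -> : (a * p - c * q) ^+ 2
      = 2 * (a ^+ 2 * p ^+ 2 + c ^+ 2 * q ^+ 2) - (a * p + c * q) ^+ 2 by ring.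
  have := sqr_ge0 (a * p + c * q).
  have := ler_wpM2l (sqr_ge0 a) p2; have := ler_wpM2l (sqr_ge0 c) q2.
  lra.
have small b : `|dev y m u b * l| <= 1 / 4.
  have lsq : (dev y m u b * l) ^+ 2 <= (1 / 4) ^+ 2.
    rewrite exprMn.
    have := ler_wpM2r (sqr_ge0 l) (sq b).
    have : 200 * L ^+ 2 * s * l ^+ 2 <= 200 * L ^+ 2 * (8 * L ^+ 2) * l ^+ 2.
      by apply/ler_wpM2r/ler_wpM2l => //; [exact: sqr_ge0|lra].
    have -> : 200 * L ^+ 2 * (8 * L ^+ 2) * l ^+ 2 = (400 * L ^+ 2 * l) ^+ 2 / 100.
      by field.
    rewrite lL; lra.
  by rewrite -sqr_le_norm//; lra.
have := expR_quadratic (small true); have := expR_quadratic (small false).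
have : l ^+ 2 * (dev y m u true ^+ 2 + dev y m u false ^+ 2) <= s * l.
  have -> : s * l = (l ^+ 2) * (400 * L ^+ 2 * s).
    by transitivity (400 * L ^+ 2 * l * (s * l)); [rewrite lL mul1r|ring].
  by rewrite ler_wpM2l ?sqr_ge0//; have := sq true; have := sq false; lra.
have : dev y m u true * l + dev y m u false * l = - (s * l).
  by rewrite -mulrDl sD mulNr.
rewrite !exprMn; lra.
Qed.

(** For a fixed estimator the points are exchanged independently, so the sum over exchanges
    factorises into n two-term sums, each at most 2. *)
Lemma sum_expR_dev (n : nat) (L : R) (y m u : 'I_n -> bool -> R) : 0 < L ->
  (forall i b, `|y i b| <= L) -> (forall i b, `|m i b| <= L) ->
  (forall i b, `|u i b| <= L) ->
  \sum_(s : {ffun 'I_n -> bool})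
     expR ((\sum_i dev (y i) (m i) (u i) (s i)) / (400 * L ^+ 2)) <= 2 ^+ n.
Proof.
move=> L0 yL mL uL.
under eq_bigr do rewrite mulr_suml expR_sum.
rewrite -(bigA_distr_bigA (fun i b =>
  expR (dev (y i) (m i) (u i) b / (400 * L ^+ 2)))).
rewrite -[n in leRHS]card_ord -prodr_const.
apply: ler_prod => i _; rewrite big_bool addr_ge0 ?expR_ge0//=.
exact: dev_expR.
Qed.

(** A union bound in exponential form. The estimator [z s] varies with the exchange, so its
    exponential is bounded by the sum over all of [N], where each term has mean at most one; 1 + x
    <= exp x then returns to the deviations at the cost of the logarithm of the cardinal. *)
Lemma sum_dev_finite (n : nat) (L : R) (y m : 'I_n -> bool -> R) (Z : finType)
    (N : {set Z}) (u : Z -> 'I_n -> bool -> R) (z : {ffun 'I_n -> bool} -> Z) :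
  0 < L -> (forall i b, `|y i b| <= L) -> (forall i b, `|m i b| <= L) ->
  (forall z i b, `|u z i b| <= L) -> (forall s, z s \in N) ->
  \sum_(s : {ffun 'I_n -> bool}) \sum_i dev (y i) (m i) (u (z s) i) (s i)
    <= 400 * L ^+ 2 * 2 ^+ n * ln #|N|%:R.
Proof.
move=> L0 yL mL uL zN; set l := 400 * L ^+ 2.
have l0 : 0 < l by rewrite /l; have := exprn_gt0 2 L0; lra.
have N0 : 0 < #|N|%:R :> R.
  by rewrite ltr0n; apply/card_gt0P; exists (z [ffun=> false]).
pose t z' (s : {ffun 'I_n -> bool}) :=
  \sum_i dev (y i) (m i) (u z' i) (s i).
have h1 s : 1 + (t (z s) s / l - ln #|N|%:R) <=
    \sum_(z' in N) expR (t z' s / l) / #|N|%:R.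
  apply: (le_trans (expR_ge1Dx _)).
  rewrite expRD expRN lnK ?posrE// (bigD1 (z s))//= lerDl.
  by apply: sumr_ge0 => ? _; rewrite divr_ge0 ?expR_ge0 ?ltW.
have h2 : \sum_s \sum_(z' in N) expR (t z' s / l) / #|N|%:R <= 2 ^+ n.
  rewrite exchange_big/=; under eq_bigr do rewrite -mulr_suml.
  rewrite -mulr_suml ler_pdivrMr// mulrC mulr_natl -sumr_const.
  by apply: ler_sum => z' _; exact: sum_expR_dev.
have := le_trans (ler_sum _ (fun s _ => h1 s)) h2.
have cst (c : R) : \sum_(s : {ffun 'I_n -> bool}) c = 2 ^+ n * c.
  by rewrite sumr_const card_ffun card_bool card_ord -[LHS]mulr_natl natrX.
rewrite big_split/= sumrB !cst -mulr_suml mulr1 /t; set S := \sum_s _ => h.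
have -> : l * 2 ^+ n * ln #|N|%:R = 2 ^+ n * ln #|N|%:R * l by ring.
by rewrite -ler_pdivrMr//; lra.
Qed.

End finite_symmetrization.

(** * Rounding to finitely many levels *)

Section rounding.
Context {R : realType}.

(** The three squares that contain the estimator have weights 2, 1 and 2, and each of them moves by
    at most 4 L e. *)
Lemma dev_close (L e : R) (y m t u : bool -> R) (b : bool) : 0 <= L ->
  (forall b, `|y b| <= L) -> (forall b, `|m b| <= L) ->
  (forall b, `|t b| <= L) -> (forall b, `|u b| <= L) ->
  (forall b, `|t b - u b| <= e) ->
  dev y m t b <= dev y m u b + 20 * L * e.
Proof.
move=> L0 yL mL tL uL tu.
have sq c z : `|z| <= L -> `|(t c - z) ^+ 2 - (u c - z) ^+ 2| <= 4 * L * e.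
  move=> zL; have -> : (t c - z) ^+ 2 - (u c - z) ^+ 2
      = (t c + u c - 2 * z) * (t c - u c) by ring.
  rewrite normrM; apply: ler_pM => //.
  move: zL (tL c) (uL c); rewrite !ler_norml => /andP[? ?] /andP[? ?] /andP[? ?].
  by apply/andP; split; lra.
have := sq (~~ b) _ (yL (~~ b)); have := sq (~~ b) _ (mL (~~ b)).
have := sq b _ (yL b).
rewrite !ler_norml /dev => /andP[? ?] /andP[? ?] /andP[? ?]; lra.
Qed.

Lemma sum_dev_VC (T : Type) (Psi : set (T -> R)) (D L : R) (n : nat)
    (x : 'I_n -> bool -> T) (y m : 'I_n -> bool -> R)
    (f : {ffun 'I_n -> bool} -> T -> R) :
  (0 < n)%N -> 0 < L -> 1 <= D -> (VC Psi <= D%:E)%E ->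
  (forall s, Psi (f s)) ->
  (forall i b, `|y i b| <= L) -> (forall i b, `|m i b| <= L) ->
  \sum_(s : {ffun 'I_n -> bool}) \sum_i
     dev (y i) (m i) (fun b => trunc L (f s (x i b))) (s i)
    <= 2 ^+ n * (840 * L ^+ 2 * D * (1 + ln n%:R)).
Proof.
move=> n0 L0 D1 VCD Pf yL mL.
have n0R : 0 < n%:R :> R by rewrite ltr0n.
pose eta := 2 * L / n%:R.
have eta0 : 0 < eta by rewrite divr_gt0//; lra.
have etan : n%:R * eta = 2 * L by rewrite mulrC divfK// gt_eqF.
(* Level 0, equal to -L, is not among the tested points: the empty maximum in [cnt] is 0 and stands
   for all values below level 1, even those under -L. *)
pose lev (k : nat) := - L + k%:R * eta.
pose p (v : 'I_n * bool * 'I_n) := (x v.1.1 v.1.2, lev v.2.+1).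
(* The rounded function is determined by the trace of the subgraph on the points [p], so traces, to
   which the VC dimension applies directly, index the finite family. *)
pose N := traces p (subgraph @` Psi).
pose cnt (B : {set 'I_n * bool * 'I_n}) i b :=
  (\max_(k : 'I_n | (i, b, k) \in B) k.+1)%N.
pose u B i b := lev (cnt B i b).
pose z s := [set v : 'I_n * bool * 'I_n | lev v.2.+1 <= f s (x v.1.1 v.1.2)]%SET.
have cntn B i b : (cnt B i b <= n)%N by apply/bigmax_leqP => k _.
have levL k : (k <= n)%N -> - L <= lev k /\ lev k <= L.
  rewrite -(ler_nat R) => /(ler_wpM2r (ltW eta0)); rewrite etan /lev => ?.
  by have := mulr_ge0 (ler0n R k) (ltW eta0); split; lra.
have uL B i b : `|u B i b| <= L.
  by rewrite ler_norml; have [? ?] := levL _ (cntn B i b); apply/andP.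
have zN s : z s \in N.
  rewrite inE; apply/asboolP; exists (subgraph (f s)); first by exists (f s).
  by move=> v; rewrite inE.
have levS k : lev k.+1 = lev k + eta by rewrite /lev -natr1; ring.
have cntlow s i b : cnt (z s) i b = 0%N \/ u (z s) i b <= f s (x i b).
  rewrite /u; have [->|] := posnP (cnt (z s) i b); first by left.
  rewrite /cnt => c0; right.
  have : (0 < #|[pred k : 'I_n | (i, b, k) \in z s]|)%N.
    rewrite lt0n; apply/negP => /eqP /card0_eq e; move: c0.
    by rewrite big_pred0// => k; have := e k; rewrite inE.
  move=> /(eq_bigmax_cond (fun k : 'I_n => k.+1))[k kz].
  by rewrite (eq_bigl (mem [pred k : 'I_n | (i, b, k) \in z s]))// => ->;
    move: kz; rewrite !inE.
have cnthigh s i b : cnt (z s) i b = n \/ f s (x i b) < u (z s) i b + eta.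
  have := cntn (z s) i b; rewrite leq_eqVlt => /predU1P[|c]; first by left.
  right; rewrite ltNge -levS; apply/negP => h.
  have kz : (i, b, Ordinal c) \in z s by rewrite inE.
  have := @leq_bigmax_cond _ (fun k => (i, b, k) \in z s)
    (fun k : 'I_n => k.+1) (Ordinal c) kz.
  by rewrite -[X in (_ < X)%N]/(cnt (z s) i b) ltnn.
have close s i b : `|trunc L (f s (x i b)) - u (z s) i b| <= eta.
  have /= := norm_trunc (f s (x i b)) (ltW L0).
  have := uL (z s) i b; rewrite !ler_norml => /andP[? ?] /andP[? ?].
  have [fL|fL] := leP (f s (x i b)) (- L).
    rewrite (trunc_le _ fL) ?(ltW L0)//.
    have [c|?] := cntlow s i b; last by apply/andP; split; lra.
    by rewrite /u c /lev mul0r; apply/andP; split; lra.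
  have [Lf|Lf] := leP L (f s (x i b)).
    rewrite (trunc_ge _ Lf) ?(ltW L0)//.
    have [c|?] := cnthigh s i b; last by apply/andP; split; lra.
    by rewrite /u c /lev etan; apply/andP; split; lra.
  rewrite trunc_id; last by rewrite ler_norml; apply/andP; split; lra.
  have [c|l] := cntlow s i b; have [c'|h] := cnthigh s i b.
  - by move: n0; rewrite -c' c.
  - by move: h; rewrite /u c /lev mul0r => h; apply/andP; split; lra.
  - by move: l; rewrite /u c' /lev etan => l; apply/andP; split; lra.
  - by apply/andP; split; lra.
have step1 : \sum_(s : {ffun 'I_n -> bool}) \sum_i
     dev (y i) (m i) (fun b => trunc L (f s (x i b))) (s i)
   <= \sum_(s : {ffun 'I_n -> bool}) \sum_i dev (y i) (m i) (u (z s) i) (s i)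
      + 2 ^+ n * (40 * L ^+ 2).
  have -> : 2 ^+ n * (40 * L ^+ 2) =
      \sum_(s : {ffun 'I_n -> bool}) \sum_(i < n) 20 * L * eta.
    rewrite !sumr_const card_ffun card_bool !card_ord -[RHS]mulr_natl natrX.
    congr (_ * _); rewrite -mulr_natl; transitivity (20 * L * (n%:R * eta)); last by ring.
    by rewrite etan; ring.
  rewrite -big_split/=; apply: ler_sum => s _; rewrite -big_split/=.
  apply: ler_sum => i _; apply: dev_close => //; first exact: ltW.
  by move=> b; apply: norm_trunc; exact: ltW.
have step2 := sum_dev_finite L0 yL mL uL zN.
have lnn0 : 0 <= ln n%:R :> R by rewrite ln_ge0// ler1n.
have lnN : ln #|N|%:R <= D * (2 + 2 * ln n%:R).
  have cN : (#|N| <= (2 * n * n).+1 ^ Num.truncn D)%N.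
    have -> : (2 * n * n)%N = #|{: 'I_n * bool * 'I_n}|.
      by rewrite !card_prod !card_ord card_bool mulnC [in RHS](mulnC n 2) mulnC.
    apply: card_traces => k q kq; rewrite truncn_ge_nat; last by lra.
    rewrite -lee_fin; apply: le_trans VCD; apply: ereal_sup_ubound.
    by exists k => //; exists q.
  have N0 : (0 < #|N|)%N.
    by apply/card_gt0P; exists (z [ffun=> false]).
  apply: (@le_trans _ _ (ln (((2 * n * n).+1 ^ Num.truncn D)%:R))).
    by rewrite ler_ln ?posrE ?ltr0n ?expn_gt0// ler_nat.
  rewrite natrX lnXn ?ltr0n//.
  have l0 : 0 <= ln (2 * n * n).+1%:R :> R by rewrite ln_ge0// ler1n.
  apply: (@le_trans _ _ (D * ln (2 * n * n).+1%:R)).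
    by rewrite -[leLHS]mulr_natl ler_wpM2r// truncn_le//; lra.
  rewrite ler_wpM2l//; first lra.
  have h3 : (2 * n * n).+1%:R <= 3 * (n%:R * n%:R) :> R.
    by rewrite -!natrM ler_nat -mulnA ltn_mul2r muln_gt0 n0.
  apply: (@le_trans _ _ (ln (3 * (n%:R * n%:R)))).
    by rewrite ler_ln ?posrE ?ltr0n// !mulr_gt0.
  rewrite !lnM ?posrE ?mulr_gt0//.
  have := @le_ln1Dx R 2; lra.
have p0 : 0 < 2 ^+ n :> R by rewrite exprn_gt0.
have h : 400 * L ^+ 2 * 2 ^+ n * ln #|N|%:R
    <= 400 * L ^+ 2 * 2 ^+ n * (D * (2 + 2 * ln n%:R)).
  by apply: ler_wpM2l lnN; apply: mulr_ge0 (ltW p0); have := exprn_gt0 2 L0; lra.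
(* As D >= 1, the rounding error is absorbed into the main term; the total constant is 840 = 2 * 400
   + 40. *)
have h' : 2 ^+ n * (40 * L ^+ 2) <= 2 ^+ n * (40 * L ^+ 2) * (D * (1 + ln n%:R)).
  rewrite ler_peMr//; last by nra.
  by apply: mulr_ge0 (ltW p0) _; have := exprn_gt0 2 L0; lra.
apply: (le_trans step1); apply: (le_trans (lerD step2 h')).
apply: (le_trans (lerD h (lexx _))).
by rewrite le_eqVlt; apply/orP; left; apply/eqP; ring.
Qed.

End rounding.

(** * Bounded measurable functions *)

Section bounded_measurable.
Context d (T : measurableType d) (R : realType).
Implicit Types (f g : T -> R).

(** A class stable under algebraic operations and integrable for every measure of mass one, in which
    real-valued integrals can be handled without separate integrability arguments. *)
Definition bmeas f := measurable_fun setT f /\ exists M, forall x, `|f x| <= M.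

Lemma bmeas_cst (c : R) : bmeas (fun=> c).
Proof. by split=> //; exists `|c|. Qed.

Lemma bmeasD f g : bmeas f -> bmeas g -> bmeas (fun x => f x + g x).
Proof.
move=> [mf [M fM]] [mg [N gN]]; split; first exact: measurable_funD.
by exists (M + N) => x; rewrite (le_trans (ler_normD _ _))// lerD.
Qed.

Lemma bmeasM f g : bmeas f -> bmeas g -> bmeas (fun x => f x * g x).
Proof.
move=> [mf [M fM]] [mg [N gN]]; split; first exact: measurable_funM.
by exists (M * N) => x; rewrite normrM ler_pM.
Qed.

Lemma bmeasN f : bmeas f -> bmeas (fun x => - f x).
Proof.
move=> [mf [M fM]]; split; first exact: measurableT_comp.
by exists M => x; rewrite normrN.
Qed.

Lemma bmeasB f g : bmeas f -> bmeas g -> bmeas (fun x => f x - g x).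
Proof. by move=> bf bg; apply: bmeasD => //; exact: bmeasN. Qed.

Lemma bmeasZ (c : R) f : bmeas f -> bmeas (fun x => c * f x).
Proof. by move=> bf; apply: bmeasM => //; exact: bmeas_cst. Qed.

Lemma bmeas_sqr f : bmeas f -> bmeas (fun x => f x ^+ 2).
Proof. by move=> bf; apply: bmeasM. Qed.

Lemma bmeas_sum (I : Type) (s : seq I) (F : I -> T -> R) :
  (forall i, bmeas (F i)) -> bmeas (fun x => \sum_(i <- s) F i x).
Proof.
move=> bF; elim: s => [|i s IH].
  by under eq_fun do rewrite big_nil; exact: bmeas_cst.
by under eq_fun do rewrite big_cons; exact: bmeasD.
Qed.

Variables (P : {measure set T -> \bar R}) (P1 : P setT = 1%E).

Lemma bmeas_integrable f : bmeas f -> P.-integrable setT (EFin \o f).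
Proof.
move=> [mf [M fM]]; apply: measurable_bounded_integrable => //.
  by rewrite P1 ltry.
exists M; split; first exact: num_real.
by move=> x Mx y _; exact: le_trans (fM y) (ltW Mx).
Qed.

Lemma bmeas_EFin f : bmeas f ->
  (\int[P]_x (f x)%:E)%E = (\int[P]_x f x)%:E.
Proof.
by move=> bf; rewrite /Rintegral fineK// integrable_fin_num// bmeas_integrable.
Qed.

Lemma Rintegral_bmeasD f g : bmeas f -> bmeas g ->
  \int[P]_x (f x + g x) = \int[P]_x f x + \int[P]_x g x.
Proof. by move=> bf bg; rewrite RintegralD//; exact: bmeas_integrable. Qed.

Lemma Rintegral_bmeasB f g : bmeas f -> bmeas g ->
  \int[P]_x (f x - g x) = \int[P]_x f x - \int[P]_x g x.
Proof. by move=> bf bg; rewrite RintegralB//; exact: bmeas_integrable. Qed.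

Lemma Rintegral_bmeasZ (c : R) f : bmeas f ->
  \int[P]_x (c * f x) = c * \int[P]_x f x.
Proof. by move=> bf; rewrite RintegralZl//; exact: bmeas_integrable. Qed.

Lemma Rintegral_prob_cst (c : R) : \int[P]_x (fun=> c) x = c.
Proof.
by rewrite Rintegral_cst// P1 mulr1.
Qed.

Lemma Rintegral_bmeas_sum (I : Type) (s : seq I) (F : I -> T -> R) :
  (forall i, bmeas (F i)) ->
  \int[P]_x (\sum_(i <- s) F i x) = \sum_(i <- s) \int[P]_x F i x.
Proof.
move=> bF; elim: s => [|i s IH].
  by under eq_Rintegral do rewrite big_nil; rewrite Rintegral_prob_cst big_nil.
under eq_Rintegral do rewrite big_cons.
by rewrite Rintegral_bmeasD ?IH ?big_cons//; exact: bmeas_sum.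
Qed.

Lemma le_Rintegral_bmeas f g : bmeas f -> bmeas g ->
  (forall x, f x <= g x) -> \int[P]_x f x <= \int[P]_x g x.
Proof. by move=> bf bg fg; apply: le_Rintegral => //; exact: bmeas_integrable. Qed.

Lemma norm_Rintegral_le f (M : R) : bmeas f -> (forall x, `|f x| <= M) ->
  `|\int[P]_x f x| <= M.
Proof.
move=> bf fM; rewrite ler_norml -[X in - X](Rintegral_prob_cst M).
rewrite -[M in _ && (_ <= M)](Rintegral_prob_cst M).
have fM' x : - M <= f x <= M by rewrite -ler_norml.
rewrite -mulN1r -Rintegral_bmeasZ; last exact: bmeas_cst.
apply/andP; split; apply: le_Rintegral_bmeas => //; try exact: bmeas_cst.
- by move=> x; rewrite mulN1r; case/andP: (fM' x).
- by move=> x; case/andP: (fM' x).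
Qed.

End bounded_measurable.

Lemma bmeas_comp d d' (T : measurableType d) (T' : measurableType d')
    (R : realType) (f : T' -> R) (h : T -> T') :
  bmeas f -> measurable_fun setT h -> bmeas (fun x => f (h x)).
Proof.
by move=> [mf [M fM]] mh; split; [exact: measurableT_comp|exists M].
Qed.

(** * Disintegration, image measures and kernels with a parameter *)

Section disintegration.
Local Open Scope ereal_scope.
Context d d' (O : measurableType d) (Z : measurableType d') (R : realType).
Variables (q : {measure set O -> \bar R}) (r : {measure set Z -> \bar R}).
Variables (k : O -> {measure set Z -> \bar R}) (A : set O).
Hypotheses (mA : measurable A).
Hypothesis mk : forall B, measurable B -> measurable_fun setT (k ^~ B).
Hypothesis rE : forall B, measurable B -> r B = \int[q]_(w in A) k w B.

Import HBNNSimple.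

Let integral_disintegration_nnsfun (f : {nnsfun Z >-> R}) :
  \int[r]_z (f z)%:E = \int[q]_(w in A) \int[k w]_z (f z)%:E.
Proof.
under [in RHS]eq_integral => w _.
  under eq_integral do rewrite fimfunE -fsumEFin//.
  rewrite ge0_integral_fsum//; last 2 first.
  - by move=> c; exact/measurable_EFinP/measurableT_comp.
  - by move=> c z _; rewrite EFinM nnfun_muleindic_ge0.
  under eq_fsbigr.
    move=> c _; rewrite integralZl_indic_nnsfun// integral_indic// setIT; over.
  over.
under [in LHS]eq_integral do rewrite fimfunE -fsumEFin//.
rewrite ge0_integral_fsum//; last 2 first.
- by move=> c; exact/measurable_EFinP/measurableT_comp.
- by move=> c z _; rewrite EFinM nnfun_muleindic_ge0.
rewrite ge0_integral_fsum//; last 2 first.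
- move=> c; apply: measurable_funeM; apply: measurable_funTS; exact: mk.
- move=> c w _; have [c0|c0] := leP 0%R c; first by rewrite mule_ge0.
  by rewrite preimage_nnfun0// measure0 mule0.
apply: eq_fsbigr => c _; rewrite integralZl_indic_nnsfun// integral_indic// setIT.
rewrite rE//; have [c0|c0] := leP 0%R c.
  by rewrite ge0_integralZl//; apply: measurable_funTS; exact: mk.
rewrite [X in _ * X]integral0_eq ?mule0 ?integral0_eq// => w _.
- by rewrite preimage_nnfun0// measure0 mule0.
- by rewrite preimage_nnfun0// measure0.
Qed.

(** Simple functions and monotone convergence. This one statement yields change of variables (Dirac
    kernels), conditioning on X_j (the kernel [Q j]), and the Markov property for functions, where
    [A] is an event of the past. *)
Lemma integral_disintegration (f : Z -> \bar R) :
  measurable_fun setT f -> (forall z, 0 <= f z) ->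
  \int[r]_z f z = \int[q]_(w in A) \int[k w]_z f z.
Proof.
move=> mf f0; pose f_ := nnsfun_approx measurableT mf.
have lim_f (m : {measure set Z -> \bar R}) :
    \int[m]_z f z = limn (fun n => \int[m]_z (f_ n z)%:E).
  rewrite -monotone_convergence//.
  - by apply: eq_integral => z _; apply/esym/cvg_lim => //; exact: cvg_nnsfun_approx.
  - by move=> n; exact/measurable_EFinP.
  - by move=> n z _; rewrite lee_fin.
  - by move=> z _ a b ab; rewrite lee_fin; exact/lefP/nd_nnsfun_approx.
rewrite lim_f; under eq_integral do rewrite lim_f.
rewrite monotone_convergence//.
- by congr (limn _); apply/funext => n; exact: integral_disintegration_nnsfun.
- move=> n; apply: measurable_funTS.
  apply: measurable_fun_integral_kernel => //.
  + by move=> z; rewrite lee_fin.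
  + exact/measurable_EFinP.
- by move=> n w _; apply: integral_ge0 => z _; rewrite lee_fin.
- move=> w _ a b ab; apply: ge0_le_integral => //.
  + by move=> z _; rewrite lee_fin.
  + exact/measurable_EFinP.
  + exact/measurable_EFinP.
  + by move=> z _; rewrite lee_fin; exact/lefP/nd_nnsfun_approx.
Qed.

End disintegration.

Lemma measurable_preimage d d' (T : measurableType d) (T' : measurableType d')
    (f : T -> T') (B : set T') :
  measurable_fun setT f -> measurable B -> measurable (f @^-1` B).
Proof. by move=> mf mB; rewrite -[X in measurable X]setTI; exact: mf. Qed.

Lemma measurable_forall d (T : measurableType d) (I : finType)
    (A : I -> set T) :
  (forall i, measurable (A i)) -> measurable [set x | forall i, A i x].
Proof.
move=> mA; rewrite (_ : [set x | _] = \bigcap_(i in [set: I]) A i).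
  by apply: fin_bigcap_measurable => //; exact: finite_finset.
by apply/seteqP; split => x h => [i _|i]; exact: h.
Qed.

Lemma measurable_exists d (T : measurableType d) (I : finType)
    (A : I -> set T) :
  (forall i, measurable (A i)) -> measurable [set x | exists i, A i x].
Proof.
move=> mA; rewrite (_ : [set x | _] = \bigcup_(i in [set: I]) A i).
  by apply: fin_bigcup_measurable => //; exact: finite_finset.
by apply/seteqP; split => x [i]; [exists i|move=> _ Ax; exists i].
Qed.

Lemma ge0_integral_image d d' (O : measurableType d) (Z : measurableType d')
    (R : realType) (mu : {measure set O -> \bar R})
    (nu : {measure set Z -> \bar R}) (h : O -> Z) (f : Z -> \bar R) :
  measurable_fun setT h ->
  (forall B, measurable B -> nu B = mu (h @^-1` B)) ->
  measurable_fun setT f -> (forall z, 0 <= f z)%E ->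
  (\int[nu]_z f z = \int[mu]_w f (h w))%E.
Proof.
move=> mh nuE mf f0.
rewrite (@integral_disintegration _ _ _ _ _ mu nu (fun w => \d_(h w)) setT)//.
- by apply: eq_integral => w _; rewrite integral_dirac// diracT mul1e.
- move=> B mB; apply: (@measurableT_comp _ _ _ _ _ _ (fun z => \d_z B)) => //.
  exact: measurable_fun_dirac.
- move=> B mB; rewrite nuE// -[X in mu X]setIT -integral_indic//.
  exact: measurable_preimage.
Qed.

Lemma Rintegral_image d d' (O : measurableType d) (Z : measurableType d')
    (R : realType) (mu : {measure set O -> \bar R})
    (nu : {measure set Z -> \bar R})
    (h : O -> Z) (f : Z -> R) :
  mu setT = 1%E -> measurable_fun setT h ->
  (forall B, measurable B -> nu B = mu (h @^-1` B)) ->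
  bmeas f -> \int[nu]_z f z = \int[mu]_w f (h w).
Proof.
move=> mu1 mh nuE bf; have nu1 : nu setT = 1%E by rewrite nuE// preimage_setT.
have [_ [M fM]] := bf.
(* Adding the bound M makes the integrand nonnegative; both measures have mass one, so M cancels at
   the end. *)
have bfM : bmeas (fun z => f z + M) by apply: bmeasD => //; exact: bmeas_cst.
have bfh : bmeas (fun w => f (h w)) by exact: bmeas_comp bf mh.
have bfhM : bmeas (fun w => f (h w) + M) by exact: bmeas_comp bfM mh.
have f0 z : (0 <= (f z + M)%:E)%E.
  by rewrite lee_fin; have := fM z; rewrite ler_norml => /andP[? _]; lra.
have mfM : measurable_fun setT (fun z => (f z + M)%:E).
  by apply/measurable_EFinP; case: bfM.
have := ge0_integral_image mh nuE mfM f0.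
rewrite !bmeas_EFin// => -[]; rewrite !Rintegral_bmeasD//; try exact: bmeas_cst.
by rewrite !Rintegral_prob_cst// => /addIr.
Qed.

Section kernel_first_coordinate.
Context d d1 d2 (T : measurableType d) (S : measurableType d1)
  (O : measurableType d2) (R : realType) (k : R.-pker T ~> O).

(** The kernel with an inert second parameter: integrals along the trajectory become jointly
    measurable in the state and the samples. *)
Definition kfst (p : T * S) : {measure set O -> \bar R} := k p.1.

Let measurable_kfst U : measurable U -> measurable_fun setT (kfst ^~ U).
Proof.
move=> mU; apply: (@measurableT_comp _ _ _ _ _ _ (k ^~ U)) => //.
exact: measurable_kernel.
Qed.

HB.instance Definition _ := isKernel.Build _ _ _ _ _ kfst measurable_kfst.

Let kfst_prob p : kfst p setT = 1%E.
Proof. exact: prob_kernel. Qed.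

HB.instance Definition _ := Kernel_isProbability.Build _ _ _ _ _ kfst kfst_prob.

Lemma ge0_measurable_kernel (g : (T * S) * O -> \bar R) :
  measurable_fun setT g -> (forall q, 0 <= g q)%E ->
  measurable_fun setT (fun p : T * S => \int[k p.1]_w g (p, w))%E.
Proof. by move=> mg g0; exact: (measurable_fun_integral_finite_kernel g kfst). Qed.

End kernel_first_coordinate.


Section transition.
Context d d1 d2 (T : measurableType d) (S : measurableType d1)
  (O : measurableType d2) (R : realType) (k : R.-pker T ~> O).

Lemma bmeas_Rintegral_kernel (g : (T * S) * O -> R) :
  bmeas g -> bmeas (fun p : T * S => \int[k p.1]_w g (p, w)).
Proof.
move=> bg; have [mg [M gM]] := bg.
have bgp p : bmeas (fun w => g (p, w)) by apply: bmeas_comp bg _.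
split; last first.
  by exists M => p; apply: norm_Rintegral_le => //; exact: prob_kernel.
have f0 q : (0 <= (g q + M)%:E)%E.
  by rewrite lee_fin; have := gM q; rewrite ler_norml => /andP[? _]; lra.
have mgM : measurable_fun setT (fun q => (g q + M)%:E).
  by apply/measurable_EFinP; apply: measurable_funD.
have -> : (fun p : T * S => \int[k p.1]_w g (p, w)) =
    (fun p : T * S => fine (\int[k p.1]_w (g (p, w) + M)%:E)%E - M).
  apply/funext => p.
  have k1 : k p.1 setT = 1%E by exact: prob_kernel.
  rewrite bmeas_EFin//; last by apply: bmeasD => //; exact: bmeas_cst.
  by rewrite Rintegral_bmeasD//= ?Rintegral_prob_cst ?addrK//; exact: bmeas_cst.
have h := ge0_measurable_kernel k mgM f0.
have h' := measurableT_comp (@fine_measurable R setT measurableT) h.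
exact: measurable_funB h' (measurable_cst M).
Qed.

End transition.

Lemma bias_variance d (O : measurableType d) (R : realType)
    (q : {measure set O -> \bar R}) (G : O -> R) (a : R) :
  q setT = 1%E -> bmeas G ->
  (\int[q]_w ((a - G w) ^+ 2)%:E
   = ((a - \int[q]_w G w) ^+ 2)%:E
     + \int[q]_w ((\int[q]_w G w - G w) ^+ 2)%:E)%E.
Proof.
move=> q1 bG; set m := \int[q]_w G w.
have bc := @bmeas_cst _ O R.
have bmG : bmeas (fun w => m - G w) by exact: bmeasB.
have b2 : bmeas (fun w => (m - G w) ^+ 2) by exact: bmeas_sqr.
rewrite !bmeas_EFin//; last exact/bmeas_sqr/bmeasB.
rewrite -EFinD; congr (_%:E).
have b3 : bmeas (fun w => 2 * (a - m) * (m - G w)) by exact: bmeasZ.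
transitivity (\int[q]_w ((a - m) ^+ 2 + (m - G w) ^+ 2 + 2 * (a - m) * (m - G w))).
  by apply: eq_Rintegral => w _; ring.
rewrite Rintegral_bmeasD//; last exact: bmeasD.
rewrite Rintegral_bmeasD// Rintegral_prob_cst// Rintegral_bmeasZ//.
by rewrite Rintegral_bmeasB// Rintegral_prob_cst// subrr mulr0 addr0.
Qed.

(** * Conditional laws *)

Section conditional_law.
Context {R : realType} {dO d : measure_display}
  {Omega : measurableType dO} {T : measurableType d}.
Variables (J : nat) (F : nat -> set (set Omega))
  (X : nat -> {mfun Omega >-> T}) (P : probability Omega R)
  (Q : nat -> R.-pker T ~> Omega).
Hypothesis XM : markov_process J F X P Q.

Let mX j : measurable_fun setT (X j). Proof. exact: measurable_funPT. Qed.

Let Q1 j x : Q j x setT = 1%E. Proof. exact: prob_kernel. Qed.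

(** Singletons of [T] may fail to be measurable, so that X_j = x almost surely is used only through
    a real function: the level set of [f] through x is measurable and has full mass. *)
Lemma ge0_integral_start j x (f : T -> R) (h1 h2 : Omega -> \bar R) :
  (j <= J)%N -> measurable_fun setT f ->
  measurable_fun setT h1 -> measurable_fun setT h2 ->
  (forall w, 0 <= h1 w)%E -> (forall w, 0 <= h2 w)%E ->
  (forall w, f (X j w) = f x -> h1 w = h2 w) ->
  (\int[Q j x]_w h1 w = \int[Q j x]_w h2 w)%E.
Proof.
move=> jJ mf mh1 mh2 h10 h20 h12; have [_ _ _ /(_ j jJ)[_ start _]] := XM.
apply: ge0_ae_eq_integral => //.
have mB : measurable (f @^-1` ~` [set f x]) by exact/measurable_preimage/measurableC.
exists (X j @^-1` (f @^-1` ~` [set f x])); split.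
- exact: measurable_preimage.
- by rewrite start// diracE memNset//= => -[].
- move=> w /= /not_implyP[_ h]; apply: contra_not h => e.
  exact: h12.
Qed.

Lemma ge0_integral_conditional j (h : Omega -> \bar R) : (j <= J)%N ->
  measurable_fun setT h -> (forall w, 0 <= h w)%E ->
  (\int[P]_w h w = \int[distribution P (X j)]_x \int[Q j x]_w h w)%E.
Proof.
move=> jJ mh h0; have [_ _ _ /(_ j jJ)[cond _ _]] := XM.
apply: integral_disintegration => // [B mB|B mB]; first exact: measurable_kernel.
by rewrite -cond// preimage_setT setIT.
Qed.

Lemma ge0_integral_distribution j (h : T -> \bar R) :
  measurable_fun setT h -> (forall x, 0 <= h x)%E ->
  (\int[distribution P (X j)]_x h x = \int[P]_w h (X j w))%E.
Proof. by move=> mh h0; apply: ge0_integral_image. Qed.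

Lemma bmeas_transition_param d' (S : measurableType d') j (g : T -> S -> R) :
  bmeas (fun p : T * S => g p.1 p.2) ->
  bmeas (fun p : T * S => \int[Q j p.1]_w g (X j.+1 w) p.2).
Proof.
move=> bg; pose G (q : T * S * Omega) := g (X j.+1 q.2) q.1.2.
have bG : bmeas G.
  apply: (bmeas_comp bg (h := fun q : T * S * Omega => (X j.+1 q.2, q.1.2))).
  apply: measurable_fun_pair; first exact: measurableT_comp.
  exact: (measurableT_comp (f := snd)).
exact: (bmeas_Rintegral_kernel (Q j) bG).
Qed.

Lemma bmeas_transition j (g : T -> R) : bmeas g ->
  bmeas (fun x => \int[Q j x]_w g (X j.+1 w)).
Proof.
move=> bg; have bG : bmeas (fun p : T * unit => g p.1) by exact: bmeas_comp bg _.
exact: (bmeas_comp (bmeas_transition_param (g := fun y _ => g y) j bG)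
  (measurable_pair2 tt)).
Qed.

(** Pythagoras for conditional expectation, pointwise in the starting state. It is stated in the
    extended reals because [a] will be a member of the approximation space, whose risk may be
    infinite. *)
Lemma bias_variance_conditional j (a g : T -> R) : (j <= J)%N ->
  measurable_fun setT a -> bmeas g ->
  let m x := \int[Q j x]_w g (X j.+1 w) in
  (\int[P]_w ((a (X j w) - g (X j.+1 w)) ^+ 2)%:E
   = \int[P]_w ((a (X j w) - m (X j w)) ^+ 2)%:E
     + \int[P]_w ((m (X j w) - g (X j.+1 w)) ^+ 2)%:E)%E.
Proof.
move=> jJ ma bg m.
have bm : bmeas m by exact: bmeas_transition.
have [mm _] := bm; have [mg _] := bg.
have mgX : measurable_fun setT (fun w => g (X j.+1 w)) by exact: measurableT_comp.
have bgX : bmeas (fun w => g (X j.+1 w)) by exact: bmeas_comp bg _.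
have msq (b : T -> R) : measurable_fun setT b ->
    measurable_fun setT (fun w => ((b (X j w) - g (X j.+1 w)) ^+ 2)%:E).
  move=> mb; apply/measurable_EFinP/measurable_funX.
  by apply: measurable_funB => //; exact: measurableT_comp.
have msqc (c : R) : measurable_fun setT (fun w => ((c - g (X j.+1 w)) ^+ 2)%:E).
  by apply/measurable_EFinP/measurable_funX/measurable_funB.
have pos (r : R) : (0 <= (r ^+ 2)%:E)%E by rewrite lee_fin sqr_ge0.
have cond (b : T -> R) : measurable_fun setT b ->
    (\int[P]_w ((b (X j w) - g (X j.+1 w)) ^+ 2)%:E
     = \int[distribution P (X j)]_x
         \int[Q j x]_w ((b x - g (X j.+1 w)) ^+ 2)%:E)%E.
  move=> mb.
  rewrite (ge0_integral_conditional jJ (msq b mb) (fun=> pos _)).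
  apply: eq_integral => x _; apply: (ge0_integral_start jJ mb) => //.
    exact: msq.
  by move=> w ->.
have mam : measurable_fun setT (fun x => ((a x - m x) ^+ 2)%:E).
  by apply/measurable_EFinP/measurable_funX/measurable_funB.
rewrite !cond// -(ge0_integral_distribution j (h := fun x => ((a x - m x) ^+ 2)%:E))//.
rewrite -ge0_integralD//; first last.
- pose G (q : T * unit * Omega) := ((m q.1.1 - g (X j.+1 q.2)) ^+ 2)%:E.
  apply: (measurableT_comp (ge0_measurable_kernel (Q j) (g := G) _ _)
    (measurable_pair2 tt)) => [|q]; last exact: pos.
  apply/measurable_EFinP/measurable_funX/measurable_funB.
    apply: (measurableT_comp (f := m)) => //.
    by apply: (measurableT_comp (f := fst)).
  by apply: (measurableT_comp (f := fun w => g (X j.+1 w))).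
- by move=> x _; apply: integral_ge0.
by apply: eq_integral => x _; rewrite bias_variance.
Qed.

End conditional_law.

(** * Ghost samples *)

Section ghost_samples.
Context {R : realType} {dO d : measure_display}
  {Omega : measurableType dO} {T : measurableType d}.
Variables (J M : nat) (X : nat -> {mfun Omega >-> T}) (P : probability Omega R)
  (PM : probability (samples (T := T) J M) R).
Hypothesis PME : is_samples_law P X PM.
Local Notation S := (samples (T := T) J M).

Definition entry (s : S) (i : 'I_J) (m : 'I_M) : T * T := tnth (tnth s i) m.

Lemma measurable_entry i m : measurable_fun setT (fun s => entry s i m).
Proof.
exact: measurableT_comp (measurable_tnth m) (measurable_tnth i).
Qed.

Lemma measurable_samples d' (V : measurableType d') (h : V -> S) :
  (forall i m, measurable_fun setT (fun v => entry (h v) i m)) ->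
  measurable_fun setT h.
Proof.
by move=> mh; apply/measurable_fun_tnthP => i; apply/measurable_fun_tnthP => m; exact: mh.
Qed.

Let mXX j : measurable_fun setT (fun w => (X j w, X j.+1 w)).
Proof. exact: measurable_fun_pair. Qed.

Lemma entry_law (i : 'I_J) (m : 'I_M) (B : set (T * T)) : measurable B ->
  PM ((fun s => entry s i m) @^-1` B) = pair_law P X i B.
Proof.
move=> mB; pose B' i' m' := if (i' == i) && (m' == m) then B else setT.
have mB' i' m' : measurable (B' i' m') by rewrite /B'; case: ifP.
have := PME mB'; rewrite (_ : [set s | _] = (fun s => entry s i m) @^-1` B).
  move=> ->; rewrite (bigD1 i)//= (bigD1 m)//= /B' !eqxx/= !big1 ?mule1//.
  - move=> i' /negbTE ->; rewrite big1// => m' _.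
    by rewrite /pair_law preimage_setT probability_setT.
  - by move=> m' /negbTE ->; rewrite /pair_law preimage_setT probability_setT.
apply/seteqP; split => [s /(_ i m)|s sB i' m']; rewrite /B'; first by rewrite !eqxx.
by case: ifP => // /andP[/eqP -> /eqP ->].
Qed.

Lemma ge0_integral_entry (i : 'I_J) (m : 'I_M) (h : T * T -> \bar R) :
  measurable_fun setT h -> (forall v, 0 <= h v)%E ->
  (\int[PM]_s h (entry s i m) = \int[P]_w h (X i w, X i.+1 w))%E.
Proof.
move=> mh h0.
rewrite -(ge0_integral_pushforward (mXX i) P (D := setT))//.
apply/esym; apply: ge0_integral_image => // [|B mB]; first exact: measurable_entry.
exact/esym/entry_law.
Qed.

Section swap.
Variables (j : 'I_J) (sg : 'I_M -> bool).

(** Only pairs of index j are replaced; the later samples, which determine the regression target at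
    time j, stay in place. *)
Definition mix (s s' : S) : S :=
  [tuple [tuple if (i == j) && sg m then entry s' i m else entry s i m
         | m < M] | i < J].

Lemma entry_mix s s' i m :
  entry (mix s s') i m = if (i == j) && sg m then entry s' i m else entry s i m.
Proof. by rewrite /entry !tnth_mktuple. Qed.

Definition swap_entries (p : S * S) : S * S := (mix p.1 p.2, mix p.2 p.1).

Lemma measurable_swap_entries : measurable_fun setT swap_entries.
Proof.
apply: measurable_fun_pair; apply: measurable_samples => i m;
  under eq_fun do rewrite entry_mix; case: ((i == j) && sg m).
all: by apply: (measurableT_comp (measurable_entry i m)).
Qed.

Definition rectangle (B B' : 'I_J -> 'I_M -> set (T * T)) : set (S * S) :=
  [set p | forall i m, B i m (entry p.1 i m) /\ B' i m (entry p.2 i m)].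

Let rect : set (set (S * S)) := [set A | exists B B',
  [/\ forall i m, measurable (B i m), forall i m, measurable (B' i m) &
      A = rectangle B B']].

(** Each entry is measurable for the generated structure, since its preimages are rectangles whose
    other sides are full; hence so is the identity map. *)
Lemma measurable_rectangles : measurable = <<s rect >>.
Proof.
have mrect A : rect A -> measurable A.
  move=> [B [B' [mB mB' ->]]].
  apply: measurable_forall => i; apply: measurable_forall => m.
  apply: measurableI; apply: measurable_preimage => //.
    exact: (measurableT_comp (measurable_entry i m)).
  exact: (measurableT_comp (measurable_entry i m)).
apply/seteqP; split; last first.
  by apply: smallest_sub => //; exact: sigma_algebra_measurable.
pose G := g_sigma_algebraType rect.
have mid : measurable_fun (T := G) setT (id : G -> S * S).
  apply/measurable_fun_pairP; split; apply: measurable_samples => i m _ B mB;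
    rewrite setTI; apply: sub_sigma_algebra.
    exists (fun i' m' => if (i' == i) && (m' == m) then B else setT), (fun _ _ => setT).
    split => // [i' m'|]; first by case: ifP.
    apply/seteqP; split => p /=.
      by move=> Bp i' m'; split => //; case: ifP => // /andP[/eqP -> /eqP ->].
    by move=> /(_ i m)[]; rewrite !eqxx.
  exists (fun _ _ => setT), (fun i' m' => if (i' == i) && (m' == m) then B else setT).
  split => // [i' m'|]; first by case: ifP.
  apply/seteqP; split => p /=.
    by move=> Bp i' m'; split => //; case: ifP => // /andP[/eqP -> /eqP ->].
  by move=> /(_ i m)[_]; rewrite !eqxx.
by move=> A mA; have := mid measurableT A mA; rewrite setTI.
Qed.

Lemma rectangle_law B B' :
  (forall i m, measurable (B i m)) -> (forall i m, measurable (B' i m)) ->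
  (PM \x PM)%E (rectangle B B') =
  (\prod_(i < J) \prod_(m < M) (pair_law P X i (B i m) * pair_law P X i (B' i m)))%E.
Proof.
move=> mB mB'.
have mS (C : 'I_J -> 'I_M -> set (T * T)) : (forall i m, measurable (C i m)) ->
    measurable [set s : S | forall i m, C i m (entry s i m)].
  move=> mC; apply: measurable_forall => i; apply: measurable_forall => m.
  exact: (measurable_preimage (measurable_entry i m)).
rewrite (_ : rectangle B B' = [set s | forall i m, B i m (entry s i m)] `*`
                              [set s | forall i m, B' i m (entry s i m)]).
  transitivity (PM [set s | forall i m, B i m (entry s i m)] *
                PM [set s | forall i m, B' i m (entry s i m)])%E.
    by apply: product_measure1E; exact: mS.
  have e (C : 'I_J -> 'I_M -> set (T * T)) (mC : forall i m, measurable (C i m)) :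
      PM [set s | forall i m, C i m (entry s i m)] =
      (\prod_(i < J) \prod_(m < M) pair_law P X i (C i m))%E by exact: PME mC.
  by rewrite !e// -big_split/=; apply: eq_bigr => i _; rewrite -big_split.
apply/seteqP; split => p /=.
  by move=> h; split => i m; have [] := h i m.
by move=> [h h'] i m; split.
Qed.

(** Rectangles form an intersection-stable generator. On them the law is a finite product in which
    the exchange permutes two factors of the same index, and these have the same law. *)
Lemma swap_entries_preserving (A : set (S * S)) : measurable A ->
  (PM \x PM)%E A = (PM \x PM)%E (swap_entries @^-1` A).
Proof.
move=> mA; pose mu' := pushforward (PM \x PM)%E swap_entries.
have PP1 : (PM \x PM)%E setT = 1%E by exact: probability_setT.
(* [mu'] is used as a bare set function; its measure structure, which depends on the measurability
   of the exchange, is supplied on the last line. *)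
have h (nu : {measure set (S * S) -> \bar R}) :
    (forall B, measurable B -> nu B = mu' B) -> (PM \x PM)%E A = nu A.
  move=> nuE; apply: (measure_unique rect (fun=> setT)) => //.
  - exact: measurable_rectangles.
  - move=> _ _ [B1 [B1' [m1 m1' ->]]] [B2 [B2' [m2 m2' ->]]].
    exists (fun i m => B1 i m `&` B2 i m), (fun i m => B1' i m `&` B2' i m).
    split => [i m|i m|]; try exact: measurableI.
    apply/seteqP; split => p /=.
      by move=> [h1 h2] i m; have [? ?] := h1 i m; have [? ?] := h2 i m.
    by move=> h; split => i m; have [[? ?] [? ?]] := h i m.
  - move=> _; exists (fun _ _ => setT), (fun _ _ => setT); split => //.
    by apply/seteqP.
  - by rewrite bigcup_const//; exists 0%N.
  - move=> _ [B [B' [mB mB' ->]]].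
    rewrite nuE; last first.
      rewrite measurable_rectangles; apply: sub_sigma_algebra.
      by exists B, B'.
    pose C i m := if (i == j) && sg m then B' i m else B i m.
    pose C' i m := if (i == j) && sg m then B i m else B' i m.
    have mC i m : measurable (C i m) by rewrite /C; case: ifP.
    have mC' i m : measurable (C' i m) by rewrite /C'; case: ifP.
    rewrite /mu' /pushforward.
    rewrite (_ : swap_entries @^-1` rectangle B B' = rectangle C C').
      apply: (eq_trans (rectangle_law mB mB')).
      apply: (eq_trans _ (esym (rectangle_law mC mC'))).
      apply: eq_bigr => i _; apply: eq_bigr => m _.
      by rewrite /C /C'; case: ifP => // _; rewrite muleC.
    apply/seteqP; split => p /= h i m; have := h i m;
      by rewrite !entry_mix /C /C'; case: ifP => // _ [].
  - by move=> _; apply: (le_lt_trans _ (ltry 1)); rewrite -PP1.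
pose nu : {measure set (S * S)%type -> \bar R} := pushforward (PM \x PM)%E swap_entries.
exact: (h (nu measurable_swap_entries)).
Qed.

End swap.
End ghost_samples.

(** * The regression estimate *)

Lemma bmeas_trunc d (V : measurableType d) (R : realType) (L : R) (f : V -> R) :
  0 <= L -> measurable_fun setT f -> bmeas (fun v => trunc L (f v)).
Proof.
move=> L0 mf; split; last by exists L => v; exact: norm_trunc.
rewrite (_ : (fun v => _) = (fun v => Num.max (- L) (Num.min L (f v)))).
  by apply: measurable_maxr => //; exact: measurable_minr.
by apply/funext => v; rewrite truncE.
Qed.

Section regression.
Context {R : realType} {dO d : measure_display}
  {Omega : measurableType dO} {T : measurableType d}.
Variables (J M : nat) (F : nat -> set (set Omega))
  (X : nat -> {mfun Omega >-> T}) (P : probability Omega R)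
  (Q : nat -> R.-pker T ~> Omega) (PM : probability (samples (T := T) J M) R).
Hypotheses (XM : markov_process J F X P Q) (PME : is_samples_law P X PM).
Local Notation S := (samples (T := T) J M).
Local Notation PP := (PM \x PM)%E.
Variables (j : 'I_J) (Psi : set (T -> R)) (L D : R) (g f : T -> S -> R).
Hypotheses (M0 : (0 < M)%N) (L0 : 0 < L) (D1 : 1 <= D).
Hypothesis VCD : (VC Psi <= D%:E)%E.
Hypothesis mg : measurable_fun setT (fun p : T * S => g p.1 p.2).
Hypothesis gL : forall y s, `|g y s| <= L.
Hypothesis g_mix : forall sg s s' y, g y (mix j sg s s') = g y s.
Hypothesis mf : measurable_fun setT (fun p : T * S => f p.1 p.2).
Hypothesis fls : forall s, is_least_squares Psi (tnth s j) (g^~ s) (f^~ s).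

Let m x s := \int[Q j x]_w g (X j.+1 w) s.
Let tf x s := trunc L (f x s).
(** [false] selects the sample and [true] the ghost. Target and estimator are computed from [p.1]
    alone, so ghost pairs are independent of both. *)
Let pt (i : 'I_M) (b : bool) (p : S * S) := entry (if b then p.2 else p.1) j i.

Let bg : bmeas (fun p : T * S => g p.1 p.2).
Proof. by split => //; exists L => p. Qed.

Let bm : bmeas (fun p : T * S => m p.1 p.2).
Proof. exact: (bmeas_transition_param X Q j bg). Qed.

Let btf : bmeas (fun p : T * S => tf p.1 p.2).
Proof. by apply: bmeas_trunc => //; exact: ltW. Qed.

Let mL x s : `|m x s| <= L.
Proof.
apply: norm_Rintegral_le => //; first exact: prob_kernel.
by apply: (bmeas_comp bg (h := fun w => (X j.+1 w, s))); exact: measurable_fun_pair.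
Qed.

Let m_mix sg s s' x : m x (mix j sg s s') = m x s.
Proof. by apply: eq_Rintegral => w _; rewrite g_mix. Qed.

Let mpt i b : measurable_fun setT (pt i b).
Proof. by case: b; apply: (measurableT_comp (measurable_entry j i)). Qed.

Let y i b p := g (pt i b p).2 p.1.
Let mv i b p := m (pt i b p).1 p.1.
Let u i b p := tf (pt i b p).1 p.1.

Let by_ i b : bmeas (y i b).
Proof.
apply: (bmeas_comp bg (h := fun p => ((pt i b p).2, p.1))).
apply: measurable_fun_pair => //; exact: (measurableT_comp (f := snd)).
Qed.

Let bmv i b : bmeas (mv i b).
Proof.
apply: (bmeas_comp bm (h := fun p => ((pt i b p).1, p.1))).
apply: measurable_fun_pair => //; exact: (measurableT_comp (f := fst)).
Qed.

Let bu i b : bmeas (u i b).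
Proof.
apply: (bmeas_comp btf (h := fun p => ((pt i b p).1, p.1))).
apply: measurable_fun_pair => //; exact: (measurableT_comp (f := fst)).
Qed.

Let PP1 : PP setT = 1%E. Proof. exact: probability_setT. Qed.

Let devp (p : S * S) : R :=
  \sum_i dev (y i ^~ p) (mv i ^~ p) (u i ^~ p) false.

Let bdev i : bmeas (fun p => dev (y i ^~ p) (mv i ^~ p) (u i ^~ p) false).
Proof.
by rewrite /dev /=; do 2?apply: bmeasB; do ?apply: bmeasZ; do ?apply: bmeasB;
  do ?apply: bmeas_sqr; do ?apply: bmeasB.
Qed.

Let bdevp : bmeas devp. Proof. exact: bmeas_sum. Qed.

(** Responses and regression function ignore the exchange, but the estimator is refitted on the
    exchanged sample: for a fixed double sample this gives one function per [sg]. *)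
Let devp_swap (sg : 'I_M -> bool) p : devp (swap_entries j sg p) =
  \sum_i dev (y i ^~ p) (mv i ^~ p)
    (fun b => trunc L (f (pt i b p).1 (swap_entries j sg p).1)) (sg i).
Proof.
apply: eq_bigr => i _.
have ptE b : pt i b (swap_entries j sg p) = pt i (b (+) sg i) p.
  by rewrite /pt /swap_entries; case: b => /=; rewrite entry_mix eqxx /=; case: (sg i).
by rewrite /dev /y /mv /u !ptE /= g_mix m_mix; case: (sg i); rewrite /= ?g_mix ?m_mix.
Qed.

(** Exchanges preserve the law, so the mean equals the mean of the average over all of them, which
    is bounded for every double sample. *)
Let Rintegral_devp : \int[PP]_p devp p <= 840 * L ^+ 2 * D * (1 + ln M%:R).
Proof.
set C := _ * (1 + _).
have eqs (sg : {ffun 'I_M -> bool}) :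
    \int[PP]_p devp (swap_entries j sg p) = \int[PP]_p devp p.
  apply/esym; apply: Rintegral_image => //; first exact: measurable_swap_entries.
  by move=> B mB; exact: swap_entries_preserving PME _ _ _ mB.
have bswap (sg : {ffun 'I_M -> bool}) : bmeas (fun p => devp (swap_entries j sg p)).
  exact: bmeas_comp bdevp (measurable_swap_entries _ _).
have p0 : 0 < 2 ^+ M :> R by rewrite exprn_gt0.
rewrite -(ler_pM2l p0).
have -> : 2 ^+ M * \int[PP]_p devp p =
    \int[PP]_p (\sum_(sg : {ffun 'I_M -> bool}) devp (swap_entries j sg p)).
  rewrite [RHS]Rintegral_bmeas_sum//.
  transitivity (\sum_(sg : {ffun 'I_M -> bool}) \int[PP]_p devp p).
    by rewrite sumr_const card_ffun card_bool card_ord -[RHS]mulr_natl natrX.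
  by apply: eq_bigr => sg _; exact/esym/eqs.
rewrite -[leRHS](Rintegral_prob_cst PP1).
apply: le_Rintegral_bmeas => //; [exact: bmeas_sum|exact: bmeas_cst|].
move=> p; under eq_bigr do rewrite devp_swap.
apply: (sum_dev_VC (Psi := Psi) (fun i b => (pt i b p).1)
  (f := fun sg : {ffun 'I_M -> bool} => f^~ (swap_entries j sg p).1)) => //.
- by move=> sg; have [] := fls (swap_entries j sg p).1.
- by move=> i b; exact: gL.
- by move=> i b; exact: mL.
Qed.

Let pos (r : R) : (0 <= (r ^+ 2)%:E)%E. Proof. by rewrite lee_fin sqr_ge0. Qed.

(** Fubini with the sample frozen: a ghost pair then has the law of (X_j, X_{j+1}). *)
Let ghostE (h : (T * T) * S -> R) i : measurable_fun setT h ->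
  (\int[PP]_p ((h (pt i true p, p.1)) ^+ 2)%:E =
   \int[PM]_s \int[P]_w ((h ((X j w, X j.+1 w), s)) ^+ 2)%:E)%E.
Proof.
move=> mh; pose H (p : S * S) := ((h (pt i true p, p.1)) ^+ 2)%:E.
have H0 p : (0 <= H p)%E by exact: pos.
have mH : measurable_fun setT H.
  apply/measurable_EFinP/measurable_funX/(measurableT_comp mh).
  exact: measurable_fun_pair.
rewrite (fubini_tonelli1 H)//.
apply: eq_integral => s _; rewrite /fubini_F.
pose h' (v : T * T) := ((h (v, s)) ^+ 2)%:E.
have h'0 v : (0 <= h' v)%E by exact: pos.
rewrite -(ge0_integral_entry PME j i (h := h'))//.
by apply/measurable_EFinP/measurable_funX/(measurableT_comp mh)/measurable_fun_pair.
Qed.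

Let muE (h : T * S -> R) : measurable_fun setT h ->
  (\int[distribution P (X j) \x PM]_p ((h p) ^+ 2)%:E =
   \int[PM]_s \int[P]_w ((h (X j w, s)) ^+ 2)%:E)%E.
Proof.
move=> mh; pose H (p : T * S) := ((h p) ^+ 2)%:E.
have H0 p : (0 <= H p)%E by exact: pos.
have mH : measurable_fun setT H by exact/measurable_EFinP/measurable_funX.
rewrite (fubini_tonelli2 H)//.
apply: eq_integral => s _; rewrite /fubini_G.
pose h' (x : T) := ((h (x, s)) ^+ 2)%:E.
have h'0 x : (0 <= h' x)%E by exact: pos.
rewrite -(ge0_integral_distribution X P j (h := h'))//.
by apply/measurable_EFinP/measurable_funX/(measurableT_comp mh)/measurable_fun_pair.
Qed.

Let noise := (\int[PM]_s \int[P]_w ((m (X j w) s - g (X j.+1 w) s) ^+ 2)%:E)%E.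

Let sumE (a : T * S -> R) i : measurable_fun setT a ->
  (\int[PP]_p ((a ((pt i true p).1, p.1) - y i true p) ^+ 2)%:E =
   \int[distribution P (X j) \x PM]_p ((a p - m p.1 p.2) ^+ 2)%:E + noise)%E.
Proof.
move=> ma.
have mX1 : measurable_fun setT (fun v : (T * T) * S => (v.1.1, v.2)).
  by apply: measurable_fun_pair => //; exact: (measurableT_comp (f := fst)).
have mX2 : measurable_fun setT (fun v : (T * T) * S => (v.1.2, v.2)).
  by apply: measurable_fun_pair => //; exact: (measurableT_comp (f := snd)).
have [mm _] := bm.
rewrite (ghostE (h := fun v => a (v.1.1, v.2) - g v.1.2 v.2)); last first.
  by apply: measurable_funB; [exact: measurableT_comp ma mX1|
    exact: measurableT_comp mg mX2].
rewrite muE; last exact: measurable_funB.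
rewrite /noise -ge0_integralD//; first last.
- pose h (q : S * Omega) := ((m (X j q.2) q.1 - g (X j.+1 q.2) q.1) ^+ 2)%:E.
  apply: (measurable_fun_fubini_tonelli_F h) => [|q]; last exact: pos.
  apply/measurable_EFinP/measurable_funX/measurable_funB.
    apply: (measurableT_comp mm (g := fun q : S * Omega => (X j q.2, q.1))).
    by apply: measurable_fun_pair => //; exact: measurableT_comp.
  apply: (measurableT_comp mg (g := fun q : S * Omega => (X j.+1 q.2, q.1))).
  by apply: measurable_fun_pair => //; exact: measurableT_comp.
- by move=> s _; apply: integral_ge0.
- pose h (q : S * Omega) := ((a (X j q.2, q.1) - m (X j q.2) q.1) ^+ 2)%:E.
  apply: (measurable_fun_fubini_tonelli_F h) => [|q]; last exact: pos.
  apply/measurable_EFinP/measurable_funX/measurable_funB.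
    apply: (measurableT_comp ma).
    by apply: measurable_fun_pair => //; exact: measurableT_comp.
  apply: (measurableT_comp mm (g := fun q : S * Omega => (X j q.2, q.1))).
  by apply: measurable_fun_pair => //; exact: measurableT_comp.
- by move=> s _; apply: integral_ge0.
apply: eq_integral => s _.
rewrite (bias_variance_conditional XM (a := fun x => a (x, s)) (g := g^~ s))//.
- exact/ltnW/ltn_ord.
- by apply: (measurableT_comp ma); exact: measurable_fun_pair.
- by apply: (bmeas_comp bg (h := fun x => (x, s))); exact: measurable_fun_pair.
Qed.

(** A predictor that does not look at the samples of index j has the same risk on sample and ghost:
    exchange all the pairs. This applies to [w] and to the regression function, not to the
    estimator. *)
Let sampleE (a : T * S -> R) i : measurable_fun setT a ->
  (forall sg s s' x, a (x, mix j sg s s') = a (x, s)) ->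
  (\int[PP]_p ((a ((pt i false p).1, p.1) - y i false p) ^+ 2)%:E =
   \int[PP]_p ((a ((pt i true p).1, p.1) - y i true p) ^+ 2)%:E)%E.
Proof.
move=> ma a_mix.
rewrite (@ge0_integral_image _ _ _ _ _ PP PP (swap_entries j (fun=> true)))//; first last.
- apply/measurable_EFinP/measurable_funX/measurable_funB; last by case: (by_ i false).
  apply: (measurableT_comp ma); apply: measurable_fun_pair => //.
  exact: (measurableT_comp (f := fst)).
- by move=> B mB; exact: swap_entries_preserving PME _ _ _ mB.
- exact: measurable_swap_entries.
apply: eq_integral => p _; rewrite /y /pt /swap_entries /=.
by rewrite !entry_mix eqxx/= a_mix g_mix.
Qed.

(** With A the squared error, V the noise and a_i the risk of the estimator on sample pair i, each
    summand of [devp] has mean A + 2 V - 2 a_i. Comparison with [w] bounds the sum of the a_i by M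
    times the squared bias plus V; the noise cancels, leaving M A on one side. *)
Lemma regression_estimate (w : T -> R) : measurable_fun setT w -> Psi w ->
  (\int[distribution P (X j) \x PM]_p ((tf p.1 p.2 - m p.1 p.2) ^+ 2)%:E <=
   (840 * L ^+ 2 * D * ((1 + ln M%:R) / M%:R))%:E
   + 2%:E * \int[distribution P (X j) \x PM]_p ((w p.1 - m p.1 p.2) ^+ 2)%:E)%E.
Proof.
move=> mw Pw; set Bi := (\int[_]_p ((w _ - _) ^+ 2)%:E)%E.
have MR : 0 < M%:R :> R by rewrite ltr0n.
have c0 : 0 <= 840 * L ^+ 2 * D * ((1 + ln M%:R) / M%:R).
  have ? : 0 <= ln M%:R :> R by rewrite ln_ge0// ler1n.
  apply: mulr_ge0; last by rewrite divr_ge0 ?addr_ge0.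
  apply: mulr_ge0; last exact: le_trans ler01 D1.
  by apply: mulr_ge0; [exact: ler0n|exact: sqr_ge0].
(* Members of [Psi] need not be square integrable; an infinite bias makes the bound trivial. *)
have [Bfin|Binf] := boolP (Bi \is a fin_num); last first.
  have -> : Bi = +oo%E.
    by apply/eqP; move: Binf; rewrite ge0_fin_numE ?integral_ge0// -leNgt leye_eq.
  by rewrite gt0_muley ?lte_fin// addey ?leey// -ltNye ltNyr.
have [mm _] := bm; have [mtf _] := btf.
have mw' : measurable_fun setT (fun p : T * S => w p.1) by exact: measurableT_comp.
pose i0 := Ordinal M0.
set A := (\int[_]_p ((tf _ _ - _) ^+ 2)%:E)%E.
pose Ar := \int[PP]_p ((u i0 true p - mv i0 true p) ^+ 2).
pose Vr := \int[PP]_p ((mv i0 true p - y i0 true p) ^+ 2).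
have b2 i b (a a' : 'I_M -> bool -> S * S -> R) : bmeas (a i b) -> bmeas (a' i b) ->
    bmeas (fun p => (a i b p - a' i b p) ^+ 2).
  by move=> ba ba'; exact/bmeas_sqr/bmeasB.
have AE i : (\int[PP]_p ((u i true p - mv i true p) ^+ 2)%:E)%E = A.
  rewrite (ghostE (h := fun v => tf v.1.1 v.2 - m v.1.1 v.2)).
    by rewrite /A (muE (h := fun p => tf p.1 p.2 - m p.1 p.2))//; exact: measurable_funB.
  have mX1 : measurable_fun setT (fun v : (T * T) * S => (v.1.1, v.2)).
    by apply: measurable_fun_pair => //; exact: (measurableT_comp (f := fst)).
  by apply: measurable_funB; [exact: measurableT_comp mtf mX1|
    exact: measurableT_comp mm mX1].
have VE i : (\int[PP]_p ((mv i true p - y i true p) ^+ 2)%:E)%E = noise.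
  rewrite (sumE (a := fun p => m p.1 p.2))// integral0_eq ?add0e// => p _.
  by rewrite subrr expr0n.
have VE' i : (\int[PP]_p ((mv i false p - y i false p) ^+ 2)%:E)%E = noise.
  by rewrite -(VE i) (sampleE (a := fun p => m p.1 p.2)).
have AVE i : (\int[PP]_p ((u i true p - y i true p) ^+ 2)%:E)%E = (A + noise)%E.
  by rewrite (sumE (a := fun p => tf p.1 p.2)).
have WE i : (\int[PP]_p ((w (pt i false p).1 - y i false p) ^+ 2)%:E)%E = (Bi + noise)%E.
  by rewrite (sampleE (a := fun p => w p.1))// (sumE (a := fun p => w p.1)).
have ArE : A = Ar%:E by rewrite -(AE i0) bmeas_EFin//; exact: b2.
have VrE : noise = Vr%:E by rewrite -(VE i0) bmeas_EFin//; exact: b2.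
have RAE i : \int[PP]_p ((u i true p - mv i true p) ^+ 2) = Ar.
  by apply: EFin_inj; rewrite -bmeas_EFin ?AE//; exact: b2.
have RVE i : \int[PP]_p ((mv i true p - y i true p) ^+ 2) = Vr.
  by apply: EFin_inj; rewrite -bmeas_EFin ?VE//; exact: b2.
have RVE' i : \int[PP]_p ((mv i false p - y i false p) ^+ 2) = Vr.
  by apply: EFin_inj; rewrite -bmeas_EFin ?VE'//; exact: b2.
have RAVE i : \int[PP]_p ((u i true p - y i true p) ^+ 2) = Ar + Vr.
  by apply: EFin_inj; rewrite -bmeas_EFin ?AVE ?ArE ?VrE//; exact: b2.
pose a i := \int[PP]_p ((u i false p - y i false p) ^+ 2).
have sum_a : \sum_i a i <= M%:R * (fine Bi + Vr).
  rewrite -lee_fin -Rintegral_bmeas_sum//; last by move=> i; exact: b2.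
  rewrite -bmeas_EFin//; last by apply: bmeas_sum => i; exact: b2.
  have -> : (M%:R * (fine Bi + Vr))%:E =
      (\sum_(i < M) \int[PP]_p ((w (pt i false p).1 - y i false p) ^+ 2)%:E)%E.
    under eq_bigr do rewrite WE VrE -(fineK Bfin) -EFinD.
    by rewrite sumEFin sumr_const card_ord -[in RHS]mulr_natl.
  have mwy i : measurable_fun setT (fun p : S * S =>
      ((w (pt i false p).1 - y i false p) ^+ 2)%:E).
    apply/measurable_EFinP/measurable_funX/measurable_funB; last by case: (by_ i false).
    apply: (measurableT_comp mw).
    exact: (measurableT_comp (f := fst)).
  rewrite -ge0_integral_sum//; apply: ge0_le_integral => //.
  - by move=> p _; rewrite lee_fin sumr_ge0// => i _; rewrite sqr_ge0.
  - have [h _] := bmeas_sum (index_enum 'I_M)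
      (fun i => b2 i false u y (bu i false) (by_ i false)).
    exact/measurable_EFinP.
  - exact: emeasurable_sum.
  move=> p _; rewrite sumEFin lee_fin.
  have [_ /(_ w Pw)] := fls p.1.
  under eq_bigr do rewrite real_normK ?num_real//.
  under [in X in _ <= X -> _]eq_bigr do rewrite real_normK ?num_real//.
  (* The responses lie in [-L, L], so truncation can only decrease the residuals; the least-squares
     property is then applied to the untruncated estimator. *)
  move=> h; rewrite (@le_trans _ _
    (\sum_(i < M) (f (entry p.1 j i).1 p.1 - y i false p) ^+ 2))//.
    by apply: ler_sum => i _; exact: trunc_sqr_le (gL _ _).
  under eq_bigr do rewrite -sqrrN opprB.
  under [leRHS]eq_bigr do rewrite -sqrrN opprB.
  exact: h.
have devE : \int[PP]_p devp p = M%:R * Ar + 2 * M%:R * Vr - 2 * \sum_i a i.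
  rewrite Rintegral_bmeas_sum//.
  have e i : \int[PP]_p dev (y i ^~ p) (mv i ^~ p) (u i ^~ p) false =
      Ar + 2 * Vr - 2 * a i.
    have bU c := b2 i c u y (bu i c) (by_ i c).
    have bV c := b2 i c mv y (bmv i c) (by_ i c).
    have bA := b2 i true u mv (bu i true) (bmv i true).
    have bUV c := bmeasB (bU c) (bV c).
    have e c : \int[PP]_p (2 * ((u i c p - y i c p) ^+ 2 - (mv i c p - y i c p) ^+ 2))
        = 2 * (\int[PP]_p ((u i c p - y i c p) ^+ 2)
               - \int[PP]_p ((mv i c p - y i c p) ^+ 2)).
      by rewrite (Rintegral_bmeasZ PP1 2 (bUV c)) (Rintegral_bmeasB PP1 (bU c) (bV c)).
    have := Rintegral_bmeasB PP1 (bmeasB (bmeasZ 2 (bUV true)) bA) (bmeasZ 2 (bUV false)).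
    rewrite (Rintegral_bmeasB PP1 (bmeasZ 2 (bUV true)) bA) !e RAVE RVE RVE' RAE => ->.
    by rewrite -/(a i); ring.
  under eq_bigr do rewrite e.
  rewrite sumrB -mulr_sumr sumr_const card_ord -[X in X - _]mulr_natl; ring.
have := Rintegral_devp; rewrite devE => h.
rewrite ArE -(fineK Bfin) -EFinM -EFinD lee_fin -(ler_pM2r MR) mulrDl.
rewrite -[X in _ <= X + _]mulrA divfK ?gt_eqF//.
move: h sum_a; set t := \sum_i a i; set C := 840 * _ * _ * _; lra.
Qed.

End regression.

(** * Finite suprema and the Markov property *)

Section finite_sup.
Context {R : realType} {KK : finType}.
Implicit Types (u : KK -> R) (A : {set KK}).

Local Notation fsup u A := (sup [set u a | a in [set` A]]).

Lemma finite_sup_attained u A : A != finset.set0 ->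
  exists2 a, a \in A & fsup u A = u a /\ forall b, b \in A -> u b <= u a.
Proof.
move=> /set0Pn[a0 a0A].
case: (@Order.TotalTheory.arg_maxP _ _ _ a0 (mem A) u a0A) => a aA amax.
exists a => //; split; last exact: amax.
apply/eqP; rewrite eq_le; apply/andP; split.
  apply: ge_sup; first by exists (u a), a.
  by move=> _ [b bA <-]; exact: amax.
apply: ub_le_sup; last by exists a.
by exists (u a) => _ [b bA <-]; exact: amax.
Qed.

Lemma le_finite_sup u A a : a \in A -> u a <= fsup u A.
Proof.
move=> aA; have [|b bA [-> bmax]] := @finite_sup_attained u A.
  by apply/set0Pn; exists a.
exact: bmax.
Qed.

Lemma norm_finite_sup u A (c : R) : A != finset.set0 ->
  (forall a, a \in A -> `|u a| <= c) -> `|fsup u A| <= c.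
Proof. by move=> A0 uc; have [a aA [-> _]] := finite_sup_attained u A0; exact: uc. Qed.

Lemma finite_sup_lip u (v : KK -> R) A (c : R) : A != finset.set0 ->
  (forall a, a \in A -> `|u a - v a| <= c) -> `|fsup u A - fsup v A| <= c.
Proof.
move=> A0 uvc; have [a aA [-> amax]] := finite_sup_attained u A0.
have [b bA [-> bmax]] := finite_sup_attained v A0.
have := uvc a aA; have := uvc b bA; have := amax b bA; have := bmax a aA.
by rewrite !ler_norml => ? ? /andP[? ?] /andP[? ?]; apply/andP; split; lra.
Qed.

Lemma measurable_finite_sup d (V : measurableType d) (u : KK -> V -> R)
    (A : V -> {set KK}) :
  (forall v, A v != finset.set0) ->
  (forall a, measurable [set v | a \in A v]) ->
  (forall a, measurable_fun setT (u a)) ->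
  measurable_fun setT (fun v => sup [set u a v | a in [set` A v]]).
Proof.
move=> A0 mA mu; apply: (measurability _ (RGenOInfty.measurableE R)) => //.
move=> /= _ [_ [c ->] <-]; rewrite setTI.
rewrite (_ : _ @^-1` _ =
    [set v | exists a, ([set v | a \in A v] `&` u a @^-1` `]c, +oo[) v]).
  apply: measurable_exists => a; apply: measurableI => //.
  exact: measurable_preimage.
apply/seteqP; split => v /=; rewrite in_itv/= andbT.
  have [a aA [-> _]] := finite_sup_attained (u ^~ v) (A0 v).
  by exists a; rewrite in_itv/= andbT.
move=> [a []]; rewrite in_itv/= andbT => aA cu.
exact: lt_le_trans cu (le_finite_sup (u ^~ v) aA).
Qed.

End finite_sup.

Section finite_valued.
Context {R : realType} d (V : measurableType d) (I : finType).

Lemma bmeas_finite_valued (N : V -> I) (g : I -> V -> R) :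
  (forall i, measurable (N @^-1` [set i])) -> (forall i, bmeas (g i)) ->
  bmeas (fun v => g (N v) v).
Proof.
move=> mN bg; have -> : (fun v => g (N v) v) =
    (fun v => \sum_i \1_(N @^-1` [set i]) v * g i v).
  apply/funext => v; rewrite (bigD1 (N v))//= indicE mem_set// mul1r.
  rewrite big1 ?addr0// => i iN; rewrite indicE memNset ?mul0r//=.
  by move=> e; move: iN; rewrite e eqxx.
apply: bmeas_sum => i; apply: bmeasM => //; split; first exact: measurable_indic.
by exists 1 => v; rewrite indicE; case: (_ \in _); rewrite ?normr1 ?normr0.
Qed.

Lemma measurable_finite_valued_preimage (J : finType) (N : V -> I) (f : I -> V -> J) j :
  (forall i, measurable (N @^-1` [set i])) ->
  (forall i, measurable (f i @^-1` [set j])) ->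
  measurable ((fun v => f (N v) v) @^-1` [set j]).
Proof.
move=> mN mf; rewrite (_ : _ @^-1` _ =
  [set v | exists i, (N @^-1` [set i] `&` f i @^-1` [set j]) v]).
  by apply: measurable_exists => i; exact: measurableI.
by apply/seteqP; split => [v fv|v [i [<-]]//]; exists (N v).
Qed.

Lemma measurable_set_valued_preimage (A : V -> {set I}) (B : {set I}) :
  (forall i, measurable [set v | i \in A v]) -> measurable (A @^-1` [set B]).
Proof.
move=> mA; rewrite (_ : _ @^-1` _ =
    [set v | forall i, [set v | (i \in A v) == (i \in B)] v]).
  apply: measurable_forall => i; case: (i \in B);
    under eq_set do rewrite ?eqb_id ?eqbF_neg.
    exact: mA.
  rewrite (_ : [set v | _] = ~` [set v | i \in A v]); first exact: measurableC.
  by apply/seteqP; split => v /=; [move/negP|move/negP].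
apply/seteqP; split => [v /= -> i//|v /= h].
by apply/setP => i; exact/eqP/h.
Qed.

End finite_valued.

Section markov_functions.
Context {R : realType} {dO d : measure_display}
  {Omega : measurableType dO} {T : measurableType d}.
Variables (J : nat) (F : nat -> set (set Omega))
  (X : nat -> {mfun Omega >-> T}) (P : probability Omega R)
  (Q : nat -> R.-pker T ~> Omega).
Hypothesis XM : markov_process J F X P Q.

Let Q1 j x : Q j x setT = 1%E. Proof. exact: prob_kernel. Qed.

Lemma Rintegral_start j x (f : T -> R) : (j <= J)%N -> bmeas f ->
  \int[Q j x]_w f (X j w) = f x.
Proof.
move=> jJ bf; have [_ _ _ /(_ j jJ)[_ start _]] := XM.
rewrite -(@Rintegral_image _ _ _ _ R (Q j x) (\d_x) (X j) f (Q1 j x))//.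
- rewrite /Rintegral integral_dirac ?diracT ?mul1e//.
  by case: bf => /measurable_EFinP.
- by move=> B mB; rewrite start.
Qed.

Lemma filtration_measurable l A : (l <= J)%N -> F l A -> measurable A.
Proof. by move=> lJ; have [[_ FM _] _ _ _] := XM; exact: FM. Qed.

(** The Markov hypothesis speaks of sets; it is a disintegration of the law of X_{l+1} restricted to
    A, and so extends to functions. *)
Let Rintegral_markov_indic j l x A (g : T -> R) : (j <= l < J)%N -> F l A ->
  bmeas g ->
  \int[Q j x]_w (\1_A w * g (X l.+1 w)) =
  \int[Q j x]_w (\1_A w * \int[Q l (X l w)]_w' g (X l.+1 w')).
Proof.
move=> /andP[jl lJ] FA bg.
have mA := filtration_measurable (ltnW lJ) FA.
have [_ _ _ /(_ j (leq_trans jl (ltnW lJ)))[_ _ /(_ x) mk]] := XM.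
have [mg [M gM]] := bg.
pose f y := (g y + M)%:E.
have f0 y : (0 <= f y)%E.
  by rewrite lee_fin; have := gM y; rewrite ler_norml => /andP[? _]; lra.
have mf : measurable_fun setT f by exact/measurable_EFinP/measurable_funD.
have mX : measurable_fun setT (X l.+1) by exact: measurable_funPT.
(* The image under X_{l+1} of the law restricted to A is disintegrated twice: into Dirac masses at
   X_{l+1}, and into the transition laws at X_l. *)
pose r' : {measure set T -> \bar R} :=
  pushforward (mrestr (Q j x) mA) (X l.+1).
pose r := r' mX.
have rE B : measurable B -> r B = Q j x (A `&` X l.+1 @^-1` B).
  by move=> mB; rewrite setIC.
pose k' w : {measure set T -> \bar R} := pushforward (Q l (X l w)) (X l.+1).
pose k := k' mX.
have mQl B : measurable B -> measurable_fun setT (fun w => k w B).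
  move=> mB.
  apply: (@measurableT_comp _ _ _ _ _ _ (fun x => Q l x (X l.+1 @^-1` B))) => //.
  exact/measurable_kernel/measurable_preimage.
have e1 := @integral_disintegration _ _ _ _ _ (Q j x) r k A mA mQl.
have e2 := @integral_disintegration _ _ _ _ _ (Q j x) r (fun w => \d_(X l.+1 w)) A mA.
have bgX : bmeas (fun w => g (X l.+1 w)) by exact: bmeas_comp bg _.
have bgt : bmeas (fun w => \int[Q l (X l w)]_w' g (X l.+1 w')).
  exact: bmeas_comp (bmeas_transition X Q l bg) _.
have b1 : bmeas (fun w => \1_A w : R).
  split; first exact: measurable_indic.
  by exists 1 => v; rewrite indicE; case: (_ \in _); rewrite ?normr1 ?normr0.
have bM : bmeas (fun w : Omega => M) by exact: bmeas_cst.
have ind (h : Omega -> R) : bmeas h ->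
    (\int[Q j x]_(w in A) (h w + M)%:E)%E =
    (\int[Q j x]_w (\1_A w * h w) + \int[Q j x]_w (\1_A w * M))%:E.
  move=> bh; rewrite -Rintegral_bmeasD//; try exact: bmeasM.
  rewrite -bmeas_EFin//; last by apply: bmeasD; exact: bmeasM.
  rewrite integral_mkcond; apply: eq_integral => w _.
  by rewrite patchE indicE; case: ifP => _; rewrite -mulrDr ?mul1r ?mul0r.
have : (\int[Q j x]_(w in A) (g (X l.+1 w) + M)%:E =
        \int[Q j x]_(w in A) (\int[Q l (X l w)]_w' g (X l.+1 w') + M)%:E)%E.
  transitivity (\int[r]_y f y)%E.
    rewrite e2//.
    - by apply: eq_integral => w _; rewrite integral_dirac// diracT mul1e.
    - move=> B mB; apply: (@measurableT_comp _ _ _ _ _ _ (fun z => \d_z B)) => //.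
      exact: measurable_fun_dirac.
    - move=> B mB; rewrite rE// setIC -integral_indic//.
      exact: measurable_preimage.
  rewrite e1//; last by move=> B mB; rewrite rE// mk ?jl.
  apply: eq_integral => w _.
  rewrite ge0_integral_pushforward//= preimage_setT bmeas_EFin//.
    by rewrite Rintegral_bmeasD ?Rintegral_prob_cst//; exact: Q1.
  exact: bmeasD.
by rewrite !ind// => -[] /addIr.
Qed.

(** A quantity known at time l may be frozen in the conditional expectation; here it will be the
    next control. *)
Lemma Rintegral_markov (I : finType) j l x (N : Omega -> I) (g : I -> T -> R) :
  (j <= l < J)%N -> (forall i, F l (N @^-1` [set i])) -> (forall i, bmeas (g i)) ->
  \int[Q j x]_w g (N w) (X l.+1 w) =
  \int[Q j x]_w \int[Q l (X l w)]_w' g (N w) (X l.+1 w').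
Proof.
move=> jl FN bg; have /andP[_ lJ] := jl.
have dec (h : I -> Omega -> R) w : h (N w) w = \sum_i \1_(N @^-1` [set i]) w * h i w.
  rewrite (bigD1 (N w))//= indicE mem_set// mul1r.
  rewrite big1 ?addr0// => i iN; rewrite indicE memNset ?mul0r//=.
  by move=> e; move: iN; rewrite e eqxx.
under eq_Rintegral do rewrite (dec (fun i w => g i (X l.+1 w))).
under [RHS]eq_Rintegral do
  rewrite (dec (fun i w => \int[Q l (X l w)]_w' g i (X l.+1 w'))).
have b1 i : bmeas (fun w => \1_(N @^-1` [set i]) w : R).
  split; first exact/measurable_indic/(filtration_measurable (ltnW lJ)).
  by exists 1 => v; rewrite indicE; case: (_ \in _); rewrite ?normr1 ?normr0.
rewrite !Rintegral_bmeas_sum//.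
- by apply: eq_bigr => i _; exact: Rintegral_markov_indic.
- by move=> i; apply: bmeasM => //; exact: bmeas_comp (bmeas_transition X Q l (bg i)) _.
- by move=> i; apply: bmeasM => //; exact: bmeas_comp (bg i) _.
Qed.

End markov_functions.

(** * The dynamic programming principle *)

Section dynamic_programming.
Context {R : realType} {dO d : measure_display}
  {Omega : measurableType dO} {T : measurableType d} {KK LL : finType}.
Variables (J : nat) (F : nat -> set (set Omega))
  (X : nat -> {mfun Omega >-> T}) (P : probability Omega R)
  (Q : nat -> R.-pker T ~> Omega)
  (K : nat -> LL -> T -> {set KK}) (H : nat -> KK -> LL -> T -> R)
  (phi : nat -> KK -> LL -> LL) (CH : R).
Hypothesis XM : markov_process J F X P Q.
Hypothesis K0 : forall j y x, (j <= J)%N -> K j y x != finset.set0.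
Hypothesis mK : forall j y a, (j <= J)%N -> measurable [set x | a \in K j y x].
Hypothesis mH : forall j a y, (j <= J)%N -> measurable_fun setT (H j a y).
Hypothesis HC : forall j a y x, (j <= J)%N -> `|H j a y x| <= CH.

(* [bellman n j] is the value at time [j] of the problem over the times
   [j, ..., j + n]. *)
Fixpoint bellman (n j : nat) (y : LL) (x : T) : R :=
  sup [set H j a y x +
         (if n is n'.+1
          then \int[Q j x]_w bellman n' j.+1 (phi j.+1 a y) (X j.+1 w)
          else 0)
      | a in [set` K j y x]].

Definition continuation (n j : nat) (z : LL) (x : T) : R :=
  if n is n'.+1 then \int[Q j x]_w bellman n' j.+1 z (X j.+1 w) else 0.

Lemma bellmanE n j y x : bellman n j y x =
  sup [set H j a y x + continuation n j (phi j.+1 a y) x | a in [set` K j y x]].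
Proof. by case: n. Qed.

Let Q1 j x : Q j x setT = 1%E. Proof. exact: prob_kernel. Qed.

Let bmH j a y : (j <= J)%N -> bmeas (H j a y).
Proof. by move=> jJ; split; [exact: mH|exists CH => x; exact: HC]. Qed.

Lemma bellman_bmeas n j : (j + n <= J)%N ->
  (forall y, bmeas (bellman n j y)) /\
  (forall y x, `|bellman n j y x| <= n.+1%:R * CH).
Proof.
elim: n j => [|n IH] j jn.
  rewrite addn0 in jn.
  have bd y x : `|bellman 0 j y x| <= 1%:R * CH.
    rewrite mul1r; apply: norm_finite_sup; first exact: K0.
    by move=> a _; rewrite addr0; exact: HC.
  split=> // y; split; last by exists (1%:R * CH) => x.
  apply: measurable_finite_sup; [by move=> x; exact: K0|by move=> a; exact: mK|].
  by move=> a; under eq_fun do rewrite addr0; exact: mH.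
have jJ : (j <= J)%N by rewrite (leq_trans _ jn)// leq_addr.
have [|IH1 IH2] := IH j.+1; first by rewrite addSnnS.
have bd y x : `|bellman n.+1 j y x| <= n.+2%:R * CH.
  apply: norm_finite_sup => [|a _]; first exact: K0.
  rewrite -natr1 addrC mulrDl mul1r (le_trans (ler_normD _ _))// lerD ?HC//.
  apply: norm_Rintegral_le => [||w]; [exact: Q1| |exact: IH2].
  exact: bmeas_comp (IH1 _) _.
split=> // y; split; last by exists (n.+2%:R * CH) => x.
apply: measurable_finite_sup; [by move=> x; exact: K0|by move=> a; exact: mK|].
move=> a; apply: measurable_funD; first exact: mH.
by case: (bmeas_transition X Q j (IH1 (phi j.+1 a y))).
Qed.

(** The bound has n summands and not n + 1, as the present cash flow is excluded: this keeps
    continuation values below W = J CH. *)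
Lemma continuation_bmeas n j z : (j + n <= J)%N ->
  bmeas (continuation n j z) /\ (forall x, `|continuation n j z x| <= n%:R * CH).
Proof.
case: n => [|n] jn.
  by split=> [|x]; [exact: bmeas_cst|rewrite normr0 mul0r].
have [|b bd] := @bellman_bmeas n j.+1; first by rewrite addSnnS.
split=> [|x]; first exact: bmeas_transition.
apply: norm_Rintegral_le => [||w]; [exact: Q1| |exact: bd].
exact: bmeas_comp (b _) _.
Qed.

Let F_finite_valued l (I I' : finType) (N : Omega -> I) (f : I -> Omega -> I') i' :
  (l <= J)%N -> (forall i, F l (N @^-1` [set i])) ->
  (forall i, F l (f i @^-1` [set i'])) ->
  F l ((fun w => f (N w) w) @^-1` [set i']).
Proof.
move=> lJ; have [[sF _ _] _ _ _] := XM.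
(* [F l] becomes the measurable structure of the space itself, so the statement on finite-valued
   maps applies to it. *)
rewrite -(measurable_g_measurableTypeE (sF l lJ)) => FN Ff.
exact: (measurable_finite_valued_preimage (V := g_sigma_algebraType (F l)) FN Ff).
Qed.

Let F_comp l (I I' : finType) (N : Omega -> I) (f : I -> I') i' :
  (l <= J)%N -> (forall i, F l (N @^-1` [set i])) ->
  F l ((fun w => f (N w)) @^-1` [set i']).
Proof.
move=> lJ FN; apply: (@F_finite_valued l I I' N (fun i _ => f i)) => // i.
have [[sF _ _] _ _ _] := XM.
rewrite -(measurable_g_measurableTypeE (sF l lJ)).
rewrite (_ : _ @^-1` _ = if f i == i' then setT else set0); first by case: ifP.
by apply/seteqP; split => w /=; case: eqP.
Qed.

(** The control is predictable: Y_{l+1} is already known at time l, as the Markov property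
    requires. *)
Let control_measurable j y A k : admissible J F X K phi j y A ->
  (j + k <= J)%N ->
  (forall z, F (j + k) ((fun w => control phi A j y w k) @^-1` [set z])) /\
  (forall z, F (j + k) ((fun w => control phi A j y w k.+1) @^-1` [set z])).
Proof.
move=> adm; have next k' : (j + k' <= J)%N ->
    (forall z, F (j + k') ((fun w => control phi A j y w k') @^-1` [set z])) ->
    (forall z, F (j + k') ((fun w => control phi A j y w k'.+1) @^-1` [set z])).
  move=> kJ Fk z; have [FA _] := adm _ (introT andP (conj (leq_addr k' j) kJ)).
  apply: (@F_finite_valued _ _ _ (fun w => control phi A j y w k')
    (fun y' w => phi (j + k'.+1)%N (A (j + k')%N w) y')) => // y'.
  by apply: (@F_comp _ _ _ (A (j + k')%N) (fun a => phi (j + k'.+1)%N a y')).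
elim: k => [|k IH] kJ.
  have F0 z : F (j + 0)%N ((fun w => control phi A j y w 0) @^-1` [set z]).
    apply: (@F_comp _ _ _ (A (j + 0)%N) (fun a => y)) => //.
    by have [] := adm _ (introT andP (conj (leq_addr 0 j) kJ)).
  by split=> //; exact: next.
have kJ' : (j + k <= J)%N by rewrite (leq_trans _ kJ)// leq_add2l.
have [_ Fk] := IH kJ'.
have Fk1 z : F (j + k.+1)%N ((fun w => control phi A j y w k.+1) @^-1` [set z]).
  have [[_ _ Fsub] _ _ _] := XM; apply: (Fsub (j + k)%N); last exact: Fk.
  by rewrite leq_add2l leqnSn.
by split=> //; exact: next.
Qed.

Section strategy.
Variables (j : nat) (y : LL) (x : T) (A : nat -> Omega -> KK).
Hypotheses (jJ : (j <= J)%N) (adm : admissible J F X K phi j y A).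

Let Y l w := control phi A j y w (l - j).
Let stage l w := H l (A l w) (Y l w) (X l w).
Let chosen l w := stage l w + continuation (J - l) l (Y l.+1 w) (X l w).

Let FY l : (j <= l <= J)%N -> forall z, F l (Y l @^-1` [set z]).
Proof.
move=> /andP[jl lJ]; have [|//] := @control_measurable j y A (l - j) adm.
  by rewrite subnKC.
by rewrite subnKC.
Qed.

Let FY1 l : (j <= l <= J)%N -> forall z, F l (Y l.+1 @^-1` [set z]).
Proof.
move=> /andP[jl lJ]; have [|//] := @control_measurable j y A (l - j) adm.
  by rewrite subnKC.
by rewrite subnKC// /Y subSn.
Qed.

Let bstage l : (j <= l <= J)%N -> bmeas (stage l).
Proof.
move=> jl; have /andP[_ lJ] := jl; have [FA _] := adm jl.
apply: (@bmeas_finite_valued _ _ _ _ (A l) (fun a w => H l a (Y l w) (X l w))) => a.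
  exact (filtration_measurable XM lJ (FA a)).
apply: (@bmeas_finite_valued _ _ _ _ (Y l) (fun y' w => H l a y' (X l w))) => y'.
  exact (filtration_measurable XM lJ (FY jl y')).
exact: bmeas_comp (bmH a y' lJ) _.
Qed.

Let bcont l : (j <= l <= J)%N ->
  bmeas (fun w => continuation (J - l) l (Y l.+1 w) (X l w)).
Proof.
move=> jl; have /andP[_ lJ] := jl.
apply: (@bmeas_finite_valued _ _ _ _ (Y l.+1)
  (fun z w => continuation (J - l) l z (X l w))) => z.
  exact (filtration_measurable XM lJ (FY1 jl z)).
have [|b _] := @continuation_bmeas (J - l) l z; first by rewrite subnKC.
exact: bmeas_comp b _.
Qed.

Let bbell l : (j <= l <= J)%N ->
  bmeas (fun w => bellman (J - l) l (Y l w) (X l w)).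
Proof.
move=> jl; have /andP[_ lJ] := jl.
apply: (@bmeas_finite_valued _ _ _ _ (Y l)
  (fun z w => bellman (J - l) l z (X l w))) => z.
  exact (filtration_measurable XM lJ (FY jl z)).
have [|b _] := @bellman_bmeas (J - l) l; first by rewrite subnKC.
exact: bmeas_comp (b z) _.
Qed.

Lemma chosen_le_bellman l w : (j <= l <= J)%N ->
  chosen l w <= bellman (J - l) l (Y l w) (X l w).
Proof.
move=> jl; have [_ AK] := adm jl; rewrite bellmanE.
rewrite /chosen /stage (_ : Y l.+1 w = phi l.+1 (A l w) (Y l w)).
  by apply: (le_finite_sup (fun a => H l a (Y l w) (X l w)
    + continuation (J - l) l (phi l.+1 a (Y l w)) (X l w))); exact: AK.
by have /andP[jl' _] := jl; rewrite /Y subSn//= addnS subnKC.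
Qed.

Let breward l : (j <= l)%N -> bmeas (fun w => \sum_(l <= i < J.+1) stage i w).
Proof.
move=> jl; rewrite (_ : (fun w => _) = fun w =>
    \sum_(i <- [seq i <- index_iota l J.+1 | (j <= i <= J)%N]) stage i w).
  pose g i w := if (j <= i <= J)%N then stage i w else 0.
  rewrite (_ : (fun w => _) = fun w =>
      \sum_(i <- [seq i <- index_iota l J.+1 | (j <= i <= J)%N]) g i w).
    apply: bmeas_sum => i; rewrite /g; case ji : (j <= i <= J)%N.
      exact: bstage.
    exact: bmeas_cst.
  apply/funext => w; rewrite !big_filter; apply: eq_bigr => i h.
  by rewrite /g h.
apply/funext => w; rewrite big_filter [LHS]big_seq_cond [RHS]big_seq_cond.
apply: eq_bigl => i; rewrite mem_index_iota ltnS; case: (leqP l i) => //= li.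
by rewrite (leq_trans jl li) andbT; case: (i <= J)%N.
Qed.

(** An exact accounting: the expected reward falls short of the recursion by the sum of the expected
    one-step losses. Nonnegative losses give the upper bound for every strategy, zero losses give
    optimality. *)
Lemma reward_bellman_gap n l : (j <= l)%N -> (l + n = J)%N ->
  \int[Q j x]_w \sum_(l <= i < J.+1) stage i w +
  \sum_(l <= i < J.+1)
     \int[Q j x]_w (bellman (J - i) i (Y i w) (X i w) - chosen i w) =
  \int[Q j x]_w bellman n l (Y l w) (X l w).
Proof.
elim: n l => [|n IH] l jl ln.
  move: ln; rewrite addn0 => lE; subst l.
  have jJJ : (j <= J <= J)%N by rewrite jJ leqnn.
  rewrite big_nat1 subnn; under eq_Rintegral do rewrite big_nat1.
  have e : (fun w => chosen J w) = stage J.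
    by apply/funext => w; rewrite /chosen subnn/= addr0.
  have bb := bbell jJJ; rewrite subnn in bb.
  under [X in _ + X]eq_Rintegral do rewrite -[chosen J _]/((fun w => chosen J w) _) e.
  by rewrite (Rintegral_bmeasB (Q1 j x) bb (bstage jJJ)) subrKC.
have lJ : (l < J)%N by rewrite -ln addnS ltnS leq_addr.
have jlJ : (j <= l <= J)%N by rewrite jl ltnW.
have jlJ' : (j <= l < J)%N by rewrite jl lJ.
have Jl : (J - l = n.+1)%N by rewrite -ln addKn.
rewrite big_ltn; last by rewrite ltnS ltnW.
under eq_Rintegral do (rewrite big_ltn; last by rewrite ltnS ltnW).
have bs := breward (leqW jl).
have bc := bcont jlJ; have bb := bbell jlJ.
rewrite (Rintegral_bmeasD (Q1 j x) (bstage jlJ) bs).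
rewrite (Rintegral_bmeasB (Q1 j x) bb (bmeasD (bstage jlJ) bc)).
rewrite (Rintegral_bmeasD (Q1 j x) (bstage jlJ) bc).
have := IH l.+1 (leqW jl); rewrite addSnnS => /(_ ln) IHl.
have [bn _] : (forall y, bmeas (bellman n l.+1 y)) /\
  (forall y x, `|bellman n l.+1 y x| <= n.+1%:R * CH).
  by apply: bellman_bmeas; rewrite addSnnS ln.
have mk := @Rintegral_markov _ _ _ _ _ _ _ _ _ _ XM _ j l x (Y l.+1)
  (fun z => bellman n l.+1 z) jlJ' (FY1 jlJ) bn.
(* The Markov property with Y_{l+1} frozen turns the expected continuation at time l into the
   expected recursion at time l + 1, and the sum telescopes. *)
have e : \int[Q j x]_w continuation (J - l) l (Y l.+1 w) (X l w) =
    \int[Q j x]_w bellman n l.+1 (Y l.+1 w) (X l.+1 w).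
  by rewrite mk; apply: eq_Rintegral => w _; rewrite Jl.
rewrite e -IHl Jl; ring.
Qed.

Lemma reward_eq : \int[Q j x]_w reward J X H phi j y A w =
  bellman (J - j) j y x - \sum_(j <= i < J.+1)
     \int[Q j x]_w (bellman (J - i) i (Y i w) (X i w) - chosen i w).
Proof.
have := @reward_bellman_gap (J - j) j (leqnn j); rewrite subnKC// => /(_ erefl).
have -> : \int[Q j x]_w bellman (J - j) j (Y j w) (X j w) = bellman (J - j) j y x.
  rewrite /Y subnn/=; apply: (Rintegral_start XM x (f := bellman (J - j) j y)) => //.
  by have [|//] := @bellman_bmeas (J - j) j; rewrite subnKC.
by move=> <-; rewrite addrK.
Qed.

Lemma reward_le : \int[Q j x]_w reward J X H phi j y A w <= bellman (J - j) j y x.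
Proof.
rewrite reward_eq gerBl big_nat_cond; apply: sumr_ge0 => i; rewrite andbT ltnS => ji.
by apply: Rintegral_ge0 => w _; rewrite subr_ge0; exact: chosen_le_bellman.
Qed.

Lemma reward_optimal :
  (forall l w, (j <= l <= J)%N -> chosen l w = bellman (J - l) l (Y l w) (X l w)) ->
  \int[Q j x]_w reward J X H phi j y A w = bellman (J - j) j y x.
Proof.
move=> opt; rewrite reward_eq big_nat_cond big1 ?subr0// => i; rewrite andbT ltnS => ji.
under eq_Rintegral do rewrite opt// subrr.
exact: Rintegral_prob_cst.
Qed.

End strategy.

(** * Measurable selection of an optimal strategy *)

Section optimal_strategy.
Variable a0 : KK.

Let quality l a y x := H l a y x + continuation (J - l) l (phi l.+1 a y) x.

Definition best_actions (l : nat) (y : LL) (x : T) : {set KK} :=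
  [set a in K l y x |
    [forall b, (b \in K l y x) ==> (quality l b y x <= quality l a y x)]].

Definition best l y x : KK := odflt a0 [pick a in best_actions l y x].

Lemma bestP l y x : (l <= J)%N ->
  best l y x \in K l y x /\ quality l (best l y x) y x = bellman (J - l) l y x.
Proof.
move=> lJ; rewrite bellmanE.
have [a aK [e amax]] :=
  finite_sup_attained (fun a => quality l a y x) (K0 y x lJ).
have : best l y x \in best_actions l y x.
  rewrite /best; case: pickP => [//|/(_ a)]; rewrite inE aK/=.
  by move=> /negbT/forallPn[b]; rewrite negb_imply => /andP[/amax ->].
rewrite inE => /andP[bK /forallP bmax]; split=> //.
rewrite -/(quality l) e; apply/eqP; rewrite eq_le amax//=.
by have := bmax a; rewrite aK.
Qed.

(** The selected action depends on x only through the finite set of maximisers, whose level sets are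
    cut out by finitely many measurable inequalities. *)
Lemma measurable_best l y a : (l <= J)%N -> measurable (best l y @^-1` [set a]).
Proof.
move=> lJ.
have mq b : measurable_fun setT (fun x => quality l b y x).
  apply: measurable_funD; first exact: mH.
  have [|[? _] _] // := @continuation_bmeas (J - l) l (phi l.+1 b y).
  by rewrite subnKC.
have mB B : measurable (best_actions l y @^-1` [set B]).
  apply: measurable_set_valued_preimage => b.
  rewrite (_ : [set x | _] = [set x | b \in K l y x] `&` [set x | forall c,
      (~` [set x | c \in K l y x] `|`
       [set x | quality l c y x <= quality l b y x]) x]).
    apply: measurableI; first exact: mK.
    apply: measurable_forall => c; apply: measurableU.
      exact/measurableC/mK.
    rewrite -[X in measurable X]setTI; exact: measurable_fun_le.
  apply/seteqP; split => x /=; rewrite inE.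
    move=> /andP[bK /forallP h]; split => // c; have := h c.
    by case: (c \in K l y x) => /= h'; [right|left].
  move=> [-> h]/=; apply/forallP => c; apply/implyP => cK.
  by have [] := h c.
apply: (@measurable_finite_valued_preimage _ _ _ _ (best_actions l y)
  (fun B x => odflt a0 [pick a in B]) a) => // B.
rewrite (_ : _ @^-1` _ = if odflt a0 [pick a in B] == a then setT else set0).
  by case: ifP.
by apply/seteqP; split => x /=; case: eqP.
Qed.

(** Strategy and control determine each other through feedback. The control is built first, with the
    action inlined, and is afterwards recognised as the control of [best_strategy]. *)
Fixpoint best_control (j : nat) (y : LL) (w : Omega) (k : nat) : LL :=
  if k is k'.+1 then
    phi (j + k)%N (best (j + k')%N (best_control j y w k') (X (j + k')%N w))
      (best_control j y w k')
  else y.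

Definition best_strategy (j : nat) (y : LL) (l : nat) (w : Omega) : KK :=
  best l (best_control j y w (l - j)) (X l w).

Lemma control_best j y w k :
  control phi (best_strategy j y) j y w k = best_control j y w k.
Proof. by elim: k => //= k ->; rewrite /best_strategy addKn. Qed.

Lemma best_admissible j y : (j <= J)%N ->
  admissible J F X K phi j y (best_strategy j y).
Proof.
move=> jJ.
have [[sF FM Fsub] FX _ _] := XM.
have Fbest l (N : Omega -> LL) : (l <= J)%N -> (forall z, F l (N @^-1` [set z])) ->
    forall a, F l ((fun w => best l (N w) (X l w)) @^-1` [set a]).
  move=> lJ FN a.
  apply: (@F_finite_valued _ _ _ N (fun z w => best l z (X l w))) => // z.
  by rewrite -[_ @^-1` _]/(X l @^-1` (best l z @^-1` [set a])); exact/FX/measurable_best.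
have Fctrl k : (j + k <= J)%N ->
    forall z, F (j + k)%N ((fun w => best_control j y w k) @^-1` [set z]).
  elim: k => [|k IH] kJ z.
    rewrite -(measurable_g_measurableTypeE (sF (j + 0)%N kJ)) /=.
    rewrite (_ : _ @^-1` _ = if y == z then setT else set0); first by case: ifP.
    by apply/seteqP; split => w /=; case: eqP.
  have kJ' : (j + k <= J)%N by rewrite (leq_trans _ kJ)// leq_add2l.
  apply: (Fsub (j + k)%N); first by rewrite leq_add2l leqnSn.
  apply: (@F_finite_valued _ _ _ (fun w => best_control j y w k)
    (fun y' w => phi (j + k.+1)%N (best (j + k)%N y' (X (j + k)%N w)) y')) => // [|y'].
    exact: IH.
  apply: (@F_comp _ _ _ (fun w => best (j + k)%N y' (X (j + k)%N w))
    (fun a => phi (j + k.+1)%N a y')) => // a.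
  by rewrite -[_ @^-1` _]/(X (j + k)%N @^-1` (best (j + k)%N y' @^-1` [set a]));
    exact/FX/measurable_best.
move=> l /andP[jl lJ]; split=> [a|w].
  apply: (Fbest l (fun w => best_control j y w (l - j))) => // z.
  by have := Fctrl (l - j)%N; rewrite subnKC//; apply.
by rewrite control_best; have [] := bestP (best_control j y w (l - j)) (X l w) lJ.
Qed.

Lemma value_bellman_of j y x : (j <= J)%N ->
  value J F X Q K H phi j y x = bellman (J - j) j y x.
Proof.
move=> jJ; have badm := best_admissible y jJ.
have opt : \int[Q j x]_w reward J X H phi j y (best_strategy j y) w =
    bellman (J - j) j y x.
  apply: reward_optimal => // l w /andP[jl lJ].
  rewrite subSn//= addnS subnKC// control_best.
  by have [_ <-] := bestP (best_control j y w (l - j)) (X l w) lJ.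
apply/eqP; rewrite eq_le; apply/andP; split.
  apply: ge_sup; first by eexists; exists (best_strategy j y).
  by move=> _ [A adm <-]; exact: reward_le.
apply: ub_le_sup; last by exists (best_strategy j y).
by exists (bellman (J - j) j y x) => _ [A adm <-]; exact: reward_le.
Qed.

End optimal_strategy.

Lemma value_bellman j y x : (j <= J)%N ->
  value J F X Q K H phi j y x = bellman (J - j) j y x.
Proof. by move=> jJ; have /set0Pn[a0 _] := K0 y x jJ; exact: value_bellman_of. Qed.

End dynamic_programming.

(** * The empirical value functions *)

(** If f x < h x, the point (x, h x) lies under one graph only and is shattered, so the dimension is
    at least 1. This settles D < 1, a range outside the regression estimate. *)
Lemma VC_lt1_subsingleton (R : realType) (T : Type) (Psi : set (T -> R)) (D : R) :
  (VC Psi <= D%:E)%E -> D < 1 -> forall f h, Psi f -> Psi h -> f = h.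
Proof.
move=> VCD D1 f h; suff wlog_ : forall f h x, Psi f -> Psi h -> ~ f x < h x.
  move=> Pf Ph; apply/funext => x; case: (ltgtP (f x) (h x)) => // lt.
    by case: (wlog_ f h x).
  by case: (wlog_ h f x).
move=> {}f {}h x Pf Ph fh.
have : (1%:R <= D :> R).
  rewrite -lee_fin; apply: le_trans VCD; apply: ereal_sup_ubound.
  exists 1%N => //; exists (fun _ => (x, h x)) => B.
  have [B1|B0] := boolP (ord0 \in B).
    exists (subgraph h); first by exists h.
    by move=> i; rewrite (ord1 i) B1 /subgraph /=; split.
  exists (subgraph f); first by exists f.
  move=> i; rewrite (ord1 i) (negbTE B0) /subgraph /=; split => //.
  by rewrite leNgt fh.
by rewrite leNgt D1.
Qed.

Lemma geom_factor_ge (R : realType) (n k : nat) : (0 < n)%N ->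
  n%:R * k%:R <= geom_factor n k :> R.
Proof.
rewrite /geom_factor; case: eqP => [->|/eqP n1 n0]; first by rewrite mul1r.
have n2 : 2 <= n%:R :> R by rewrite ler_nat; case: n n1 n0 => [|[]].
rewrite ler_pdivlMr; last lra.
elim: k => [|k IH]; first by rewrite mulr0 mul0r expr1 subrr.
rewrite exprS -natr1; have k0 : 0 <= k%:R :> R by [].
have : n%:R * (n%:R * k%:R * (n%:R - 1)) <= n%:R * (n%:R ^+ k.+1 - n%:R) :> R.
  by rewrite ler_pM2l//; lra.
have : n%:R * k%:R * (n%:R - 1) <= n%:R * (n%:R * k%:R * (n%:R - 1)) :> R.
  rewrite ler_peMl//; last lra.
  by rewrite !mulr_ge0//; lra.
lra.
Qed.

Lemma geom_factor0 (R : realType) (k : nat) : geom_factor 0 k = 0 :> R.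
Proof. by rewrite /geom_factor/= expr0n/= subrr mul0r. Qed.

(** * The norm of order two *)

Section Lnorm2.
Context d (V : measurableType d) (R : realType) (mu : {measure set V -> \bar R}).
Implicit Types f g : V -> R.

Lemma Lnorm2E f : ('N[mu]_2%:E [(fun x => (f x)%:E)] =
  (\int[mu]_x (f x ^+ 2)%:E) `^ 2^-1)%E.
Proof.
rewrite unlock; congr (_ `^ _)%E; apply: eq_integral => x _.
by rewrite abse_EFin poweR_EFin powR_mulrn// real_normK ?num_real.
Qed.

Lemma Lnorm2_fin f (i : R) : (\int[mu]_x (f x ^+ 2)%:E = i%:E)%E -> 0 <= i ->
  ('N[mu]_2%:E [(fun x => (f x)%:E)] = (Num.sqrt i)%:E)%E.
Proof. by move=> e i0; rewrite Lnorm2E e poweR_EFin powR12_sqrt. Qed.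

End Lnorm2.

Lemma Lnorm2_le d d' (V : measurableType d) (V' : measurableType d')
    (R : realType) (mu : {measure set V -> \bar R})
    (nu : {measure set V' -> \bar R}) (f : V -> R) (g : V' -> R) :
  (\int[mu]_x (f x ^+ 2)%:E <= \int[nu]_x (g x ^+ 2)%:E)%E ->
  ('N[mu]_2%:E [(fun x => (f x)%:E)] <= 'N[nu]_2%:E [(fun x => (g x)%:E)])%E.
Proof.
move=> fg; rewrite !Lnorm2E; apply: gt0_ler_poweR => //.
all: by rewrite in_itv/= leey andbT integral_ge0// => x _; rewrite lee_fin sqr_ge0.
Qed.

Section Lnorm2_theory.
Context d (V : measurableType d) (R : realType) (mu : {measure set V -> \bar R}).
Implicit Types f g : V -> R.

Lemma Lnorm2_mono f g : measurable_fun setT f -> measurable_fun setT g ->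
  (forall x, `|f x| <= `|g x|) ->
  ('N[mu]_2%:E [(fun x => (f x)%:E)] <= 'N[mu]_2%:E [(fun x => (g x)%:E)])%E.
Proof.
move=> mf mg fg; apply: Lnorm2_le; apply: ge0_le_integral => //.
- by move=> x _; rewrite lee_fin sqr_ge0.
- exact/measurable_EFinP/measurable_funX.
- exact/measurable_EFinP/measurable_funX.
- move=> x _; rewrite lee_fin -[leRHS]real_normK ?num_real//.
  by rewrite sqr_le_norm.
Qed.

Lemma Lnorm2_sum (I : Type) (s : seq I) (f : I -> V -> R) (g : V -> R) (e : R) :
  (forall i, measurable_fun setT (f i)) -> measurable_fun setT g ->
  (forall i, 'N[mu]_2%:E [(fun x => (f i x)%:E)] <= e%:E)%E ->
  ('N[mu]_2%:E [(fun x => (\sum_(i <- s) f i x + g x)%:E)] <=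
   ((size s)%:R * e)%:E + 'N[mu]_2%:E [(fun x => (g x)%:E)])%E.
Proof.
move=> mf mg fe; elim: s => [|i s IH].
  by rewrite mul0r add0e; under eq_fun do rewrite big_nil add0r.
under eq_fun do rewrite big_cons -addrA.
have ms : measurable_fun setT (fun x => \sum_(i <- s) f i x + g x).
  by apply: measurable_funD => //; exact: measurable_sum.
have le12 : 1 <= 2 :> R by lra.
apply: (le_trans (minkowski_EFin mu (mf i) ms le12)).
have -> : ((size (i :: s))%:R * e)%:E = (e%:E + ((size s)%:R * e)%:E)%E.
  by rewrite -EFinD /= -natr1; congr (_%:E); ring.
rewrite -addeA.
by apply: leeD; [exact: fe|exact: IH].
Qed.

End Lnorm2_theory.

(** * Measurability of the empirical values and their dependence on the samples *)

Section empirical_value.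
Context {R : realType} {dO d : measure_display}
  {Omega : measurableType dO} {T : measurableType d} {KK LL : finType}.
Variables (J M : nat) (K : nat -> LL -> T -> {set KK})
  (H : nat -> KK -> LL -> T -> R) (phi : nat -> KK -> LL -> LL) (W CH : R).
Local Notation S := (samples (T := T) J M).
Variables (C : nat -> LL -> T -> S -> R) (Psi : nat -> set (T -> R)).
Hypothesis W0 : 0 <= W.
Hypothesis K0 : forall j y x, (j <= J)%N -> K j y x != finset.set0.
Hypothesis mK : forall j y a, (j <= J)%N -> measurable [set x | a \in K j y x].
Hypothesis mH : forall j a y, (j <= J)%N -> measurable_fun setT (H j a y).
Hypothesis HC : forall j a y x, (j <= J)%N -> `|H j a y x| <= CH.
Hypothesis CP : is_empirical_projection K H phi W C Psi.

Local Notation v_ := (vM K H phi W C).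

Lemma measurable_G_measurable j (f : T -> S -> R) :
  G_measurable j f -> measurable_fun setT (fun p : T * S => f p.1 p.2).
Proof.
move=> mf _ U mU; rewrite setTI; have := mf U mU.
apply: smallest_sub; first exact: sigma_algebra_measurable.
move=> _ [B mB [A GA <-]]; apply: measurableX => //.
move: A GA; apply: smallest_sub; first exact: sigma_algebra_measurable.
move=> _ [i [m [B' [ji mB' ->]]]].
exact: (measurable_preimage (measurable_entry i m)).
Qed.

Lemma sigma_algebra_indistinguishable (V : Type) (s s' : V) :
  sigma_algebra setT [set A : set V | A s <-> A s'].
Proof.
split => //= [A AE|A AE].
  by move: AE; rewrite /setD /=; tauto.
by split=> -[n _ h]; exists n => //; apply/AE.
Qed.

(** Sets that do not separate (x, s) from (x, s') form a sigma-algebra containing the generators,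
    hence also the level set of [f] through (x, s). *)
Lemma G_measurable_agree j (f : T -> S -> R) (s s' : S) x :
  G_measurable j f ->
  (forall (i : 'I_J), (j <= i)%N -> tnth s i = tnth s' i) -> f x s = f x s'.
Proof.
move=> mf ss'; have /(_ [set f x s] (measurable_set1 _)) := mf.
move=> /(_ [set B | B (x, s) <-> B (x, s')]).
move=> H0; suff : (f x s = f x s <-> f x s' = f x s) by move=> [/(_ erefl)].
apply: H0; split; first exact: sigma_algebra_indistinguishable.
move=> _ [B mB [A GA <-]] /=; suff : A s <-> A s' by tauto.
move: GA => /(_ [set A | A s <-> A s']); apply; split.
  exact: sigma_algebra_indistinguishable.
by move=> _ [i [m [B' [ji mB' ->]]]] /=; rewrite ss'.
Qed.

Lemma C_measurable j z : (j < J)%N ->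
  measurable_fun setT (fun p : T * S => C j z p.1 p.2).
Proof.
by move=> jJ; have [_ mC] := CP (Ordinal jJ) z; exact: measurable_G_measurable mC.
Qed.

(** The projections entering at time j + 1 see only samples of index above j, whereas the exchange
    acts at index j. This invariance carries the independence of the samples at different times. *)
Lemma vM_mix (j : 'I_J) y x sg s s' : v_ j.+1 y x (mix j sg s s') = v_ j.+1 y x s.
Proof.
rewrite /vM; case: ifP => // jJ; congr sup.
have e a : C j.+1 (phi j.+2 a y) x (mix j sg s s') = C j.+1 (phi j.+2 a y) x s.
  have [_ mC] := CP (Ordinal jJ) (phi j.+2 a y).
  apply: (G_measurable_agree x mC) => i /= ji; apply: eq_from_tnth => m.
  by rewrite -/(entry _ i m) entry_mix gt_eqF.
by apply/seteqP; split => _ [a aK <-]; exists a => //; rewrite e.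
Qed.

Lemma vM_bmeas j y : (j <= J)%N ->
  measurable_fun setT (fun p : T * S => v_ j y p.1 p.2) /\
  (forall x s, `|v_ j y x s| <= CH + W).
Proof.
move=> jJ; rewrite /vM; have mK1 a : measurable [set p : T * S | a \in K j y p.1].
  exact: (measurable_preimage measurable_fst (mK y a jJ)).
have mH1 a : measurable_fun setT (fun p : T * S => H j a y p.1).
  by apply: measurableT_comp => //; exact: mH.
case lt : (j < J)%N; split => [|x s].
- apply: (measurable_finite_sup (u := fun a (p : T * S) =>
    H j a y p.1 + trunc W (C j (phi j.+1 a y) p.1 p.2)) (A := fun p => K j y p.1)) => //.
    by move=> p; exact: K0.
  move=> a; apply: measurable_funD => //.
  have [h _] := bmeas_trunc W0 (C_measurable (phi j.+1 a y) lt); exact: h.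
- apply: norm_finite_sup => [|a _]; first exact: K0.
  by rewrite (le_trans (ler_normD _ _))// lerD ?HC// norm_trunc.
- apply: (measurable_finite_sup (u := fun a (p : T * S) => H j a y p.1)
    (A := fun p => K j y p.1)) => //.
  by move=> p; exact: K0.
- apply: norm_finite_sup => [|a _]; first exact: K0.
  by rewrite (le_trans (HC _ _ _ _))// lerDl.
Qed.

End empirical_value.

(** * Error propagation *)

Section error_propagation.
Context {R : realType} {dO d : measure_display}
  {Omega : measurableType dO} {T : measurableType d} {KK LL : finType}.
Variables (J M : nat) (F : nat -> set (set Omega))
  (X : nat -> {mfun Omega >-> T}) (P : probability Omega R)
  (Q : nat -> R.-pker T ~> Omega)
  (K : nat -> LL -> T -> {set KK}) (H : nat -> KK -> LL -> T -> R)
  (phi : nat -> KK -> LL -> LL) (CH : R) (Psi : nat -> set (T -> R))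
  (PM : probability (samples (T := T) J M) R)
  (C : nat -> LL -> T -> samples (T := T) J M -> R) (delta D c : R).
Local Notation S := (samples (T := T) J M).
Local Notation W := (J%:R * CH).
Local Notation v_ := (vM K H phi W C).
Local Notation Ct := (Ctilde X Q K H phi W C).
Local Notation mu j := (distribution P (X j)).
Hypothesis M0 : (0 < M)%N.
Hypothesis XM : markov_process J F X P Q.
Hypothesis K0 : forall j y x, (j <= J)%N -> K j y x != finset.set0.
Hypothesis mK : forall j y a, (j <= J)%N -> measurable [set x | a \in K j y x].
Hypothesis mH : forall j a y, (j <= J)%N -> measurable_fun setT (H j a y).
Hypothesis HC : forall j a y x, (j <= J)%N -> `|H j a y x| <= CH.
Hypothesis W1 : 1 <= W.
Hypothesis mPsi : forall j w, (j <= J)%N -> Psi j w -> measurable_fun setT w.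
Hypothesis PME : is_samples_law P X PM.
Hypothesis CP : is_empirical_projection K H phi W C Psi.
Hypotheses (delta0 : 0 < delta) (D0 : 0 < D) (cE : c = 3360).
Hypothesis bias : forall j, (j < J)%N ->
    (ereal_sup (range (fun z : LL => ereal_inf
       [set 'N[mu j \x PM]_2%:E
              [(fun xs => (Ct j z xs.1 xs.2 - w xs.1)%:E)]
       | w in Psi j])) <= delta%:E)%E.
Hypothesis VCD : forall j, (j < J)%N -> (VC (Psi j) <= D%:E)%E.

Let W0 : 0 <= W. Proof. exact: le_trans ler01 W1. Qed.

Let CH0 : 0 < CH.
Proof.
rewrite ltNge; apply/negP => h; have := W1; rewrite leNgt => /negP; apply.
by rewrite (le_lt_trans _ ltr01)// mulr_ge0_le0.
Qed.

Let CH_W : (0 < J)%N -> CH <= W.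
Proof. by move=> J0; rewrite ler_peMl ?ler1n// ltW. Qed.

Let c0 : 0 <= c. Proof. by rewrite cE; exact: ler0n. Qed.

Let eps0 := c * W ^+ 4 * ((1 + ln M%:R) / M%:R) * D.

Let eps0_ge0 : 0 <= eps0.
Proof.
have ? : 0 <= ln M%:R :> R by rewrite ln_ge0// ler1n.
rewrite /eps0; apply: mulr_ge0 (ltW D0); apply: mulr_ge0.
  by apply: mulr_ge0 c0 _; exact: exprn_ge0.
by rewrite divr_ge0 ?addr_ge0.
Qed.

Let bv j y : (j <= J)%N -> bmeas (fun p : T * S => v_ j y p.1 p.2).
Proof.
move=> jJ; have [mv bd] := vM_bmeas W0 K0 mK mH HC CP y jJ.
by split=> //; exists (CH + W) => p.
Qed.

Let bCt j z : (j < J)%N -> bmeas (fun p : T * S => Ct j z p.1 p.2).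
Proof. by move=> jJ; apply: bmeas_transition_param; exact: bv. Qed.

Let tC j z (p : T * S) := trunc W (C j z p.1 p.2) - trunc W (Ct j z p.1 p.2).

Let btC j z : (j < J)%N -> bmeas (tC j z).
Proof.
move=> jJ; apply: bmeasB; first exact: bmeas_trunc W0 (C_measurable CP z jJ).
by apply: bmeas_trunc W0 _; case: (bCt z jJ).
Qed.

Let estimation_sqr j z w : (j < J)%N -> Psi j w ->
  (\int[mu j \x PM]_p ((tC j z p) ^+ 2)%:E <=
   eps0%:E + 2%:E * \int[mu j \x PM]_p ((Ct j z p.1 p.2 - w p.1) ^+ 2)%:E)%E.
Proof.
move=> jJ Pw; set I := (\int[_]_p ((Ct _ _ _ _ - _) ^+ 2)%:E)%E.
have mw := mPsi (ltnW jJ) Pw.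
have [mC _] := bCt z jJ; have [mt _] := btC z jJ.
have mCw : measurable_fun setT (fun p : T * S => ((Ct j z p.1 p.2 - w p.1) ^+ 2)%:E).
  apply/measurable_EFinP/measurable_funX/measurable_funB => //.
  exact: measurableT_comp.
have m_tC : measurable_fun setT (fun p : T * S => ((tC j z p) ^+ 2)%:E).
  exact/measurable_EFinP/measurable_funX.
have I0 : (0 <= I)%E by apply: integral_ge0 => p _; rewrite lee_fin sqr_ge0.
have J0 : (0 < J)%N by rewrite (leq_ltn_trans _ jJ).
(* For D < 1 the space is reduced to [w], so the projection is [w] and its error is pure bias. *)
have [D1|D1] := ltP D 1.
  have CE s : C j z ^~ s = w.
    have [/(_ s) [PC _] _] := CP (Ordinal jJ) z.
    exact: (VC_lt1_subsingleton (VCD jJ) D1 PC Pw).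
  apply: (@le_trans _ _ I).
    apply: ge0_le_integral => // p _; rewrite lee_fin ?sqr_ge0//.
    rewrite -[leRHS]real_normK ?num_real// sqr_le_norm//.
    rewrite /tC (_ : C j z p.1 p.2 = w p.1); last by rewrite -(CE p.2).
    by rewrite [leRHS]distrC; exact: trunc_lip W0.
  rewrite -[leLHS]add0e; apply: leeD; first by rewrite lee_fin.
  by rewrite -[leLHS]mul1e lee_wpmul2r// lee_fin; lra.
pose L := 2 * W.
have L0 : 0 < L by rewrite mulr_gt0// (lt_le_trans ltr01 W1).
have [mv vb] := vM_bmeas W0 K0 mK mH HC CP z jJ.
have vL x s : `|v_ j.+1 z x s| <= L.
  by rewrite (le_trans (vb x s))// /L mulrDl mul1r lerD2r CH_W.
have reg := regression_estimate (Psi := Psi j) (f := C j z) XM PME M0 L0 D1 (VCD jJ) mv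
  vL (fun sg s s' y => vM_mix CP (Ordinal jJ) z y sg s s').
have := reg (C_measurable CP z jJ) (fun s => (CP (Ordinal jJ) z).1 s) w mw Pw.
rewrite [X in (_ + _ * X)%E](_ : _ = I); last first.
  by apply: eq_integral => p _; rewrite -sqrrN opprB.
move=> h; apply: (@le_trans _ _ (\int[mu j \x PM]_p
    ((trunc L (C j z p.1 p.2) - Ct j z p.1 p.2) ^+ 2)%:E)%E).
  apply: ge0_le_integral => //.
  - by move=> p _; rewrite lee_fin sqr_ge0.
  - apply/measurable_EFinP/measurable_funX/measurable_funB => //.
    by case: (bmeas_trunc (ltW L0) (C_measurable CP z jJ)).
  move=> p _; rewrite lee_fin -[leRHS]real_normK ?num_real// sqr_le_norm//.
  rewrite /tC -(@trunc_trunc _ W L (C j z p.1 p.2))//; last first.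
    by rewrite /L ler_peMl// ler1n.
  exact: trunc_lip.
apply: (le_trans h); apply: leeD => //; rewrite lee_fin.
(* With L = 2 W the constant is 840 * 4 = 3360 and the power of W is 2; W >= 1 raises it to 4. *)
rewrite /eps0 /L exprMn.
rewrite [leLHS](_ : _ = c * W ^+ 2 * ((1 + ln M%:R) / M%:R) * D); last first.
  by rewrite cE; ring.
rewrite ler_wpM2r ?(ltW D0)// ler_wpM2r//.
  by rewrite divr_ge0// addr_ge0// ln_ge0// ler1n.
by apply: ler_wpM2l c0 _ _ _; rewrite ler_weXn2l.
Qed.

Let eps := Num.sqrt eps0 + Num.sqrt 2 * delta.

Let eps_ge0 : 0 <= eps.
Proof. by rewrite addr_ge0 ?mulr_ge0 ?sqrtr_ge0 ?(ltW delta0). Qed.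

Let mP1 j : (mu j \x PM)%E setT = 1%E. Proof. exact: probability_setT. Qed.

Let estimation_norm j z : (j < J)%N ->
  ('N[mu j \x PM]_2%:E [(fun p => (tC j z p)%:E)] <= eps%:E)%E.
Proof.
move=> jJ; have b2 := bmeas_sqr (btC z jJ).
pose A := \int[(mu j \x PM)%E]_p (tC j z p ^+ 2).
have AE : (\int[mu j \x PM]_p (tC j z p ^+ 2)%:E)%E = A%:E.
  exact (bmeas_EFin (mP1 j) b2).
have A0 : 0 <= A by apply: Rintegral_ge0 => p _; exact: sqr_ge0.
rewrite (Lnorm2_fin AE A0) lee_fin.
(* The infimum over the space need not be attained. The estimate is read backwards: the left side is
   a lower bound of all the distances, hence of their infimum. If A < eps0 the square root is 0 by
   convention. *)
have r_delta : Num.sqrt ((A - eps0) / 2) <= delta.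
  rewrite -lee_fin; apply: le_trans (bias jJ).
  apply: le_trans (ereal_sup_ubound _); last by exists z.
  apply: le_ereal_inf_tmp => _ [w Pw <-].
  set I := (\int[mu j \x PM]_p ((Ct j z p.1 p.2 - w p.1) ^+ 2)%:E)%E.
  have I0 : (0 <= I)%E by apply: integral_ge0 => p _; rewrite lee_fin sqr_ge0.
  have := estimation_sqr z jJ Pw; rewrite AE -/I.
  have [Ifin|Ioo] := boolP (I \is a fin_num); last first.
    move=> _; have IE : I = +oo%E.
      by apply/eqP; move: Ioo; rewrite ge0_fin_numE// -leNgt leye_eq.
    by rewrite Lnorm2E -/I IE poweRyr ?leey// invr_eq0 pnatr_eq0.
  have IE := fineK Ifin.
  rewrite -IE -EFinM -EFinD lee_fin => h.
  rewrite (Lnorm2_fin (esym IE)) ?fine_ge0// lee_fin ler_wsqrtr//.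
  by rewrite ler_pdivrMr//; lra.
have A2 : A <= eps0 + 2 * delta ^+ 2.
  have [h|h] := leP ((A - eps0) / 2) 0.
    by have := sqr_ge0 delta; lra.
  have : Num.sqrt ((A - eps0) / 2) ^+ 2 <= delta ^+ 2.
    by rewrite sqr_le_norm ?(ltW delta0)// ger0_norm// sqrtr_ge0.
  by rewrite sqr_sqrtr ?(ltW h)//; lra.
rewrite -[leRHS]ger0_norm// -sqrtr_sqr ler_wsqrtr// (le_trans A2)//.
rewrite /eps sqrrD exprMn !sqr_sqrtr//.
have : 0 <= Num.sqrt eps0 * (Num.sqrt 2 * delta).
  by rewrite !mulr_ge0 ?sqrtr_ge0 ?(ltW delta0).
lra.
Qed.

Let Err j (p : T * S) := sup (range (fun z : LL =>
  `|v_ j z p.1 p.2 - value J F X Q K H phi j z p.1|)).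

Variable z0 : LL.

Let rangeE (u : LL -> R) : range u = [set u a | a in [set` [set: LL]%SET]].
Proof. by apply/seteqP; split => _ [z _ <-]; exists z => //=; rewrite inE. Qed.

Let LLn0 : [set: LL]%SET != finset.set0.
Proof. by apply/set0Pn; exists z0; rewrite inE. Qed.

Let ErrE j p : (j <= J)%N -> Err j p =
  sup [set `|v_ j z p.1 p.2 - bellman X Q K H phi (J - j) j z p.1|
      | z in [set` [set: LL]%SET]].
Proof.
move=> jJ; rewrite /Err rangeE; congr sup.
have valE z := value_bellman phi XM K0 mK mH HC z p.1 jJ.
by apply/seteqP; split => _ [z zL <-]; exists z => //; rewrite valE.
Qed.

Let bErr j : (j <= J)%N -> bmeas (Err j).
Proof.
move=> jJ; have [|bb bd] := bellman_bmeas X Q phi K0 mK mH HC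
  (n := J - j) (j := j).
  by rewrite subnKC.
have bdiff z : bmeas (fun p : T * S =>
    `|v_ j z p.1 p.2 - bellman X Q K H phi (J - j) j z p.1|).
  have [m1 [M1 h1]] := bmeasB (bv z jJ) (bmeas_comp (bb z) (measurable_fst (T2 := S))).
  by split; [exact: measurableT_comp|exists M1 => p; rewrite normr_id].
split.
  rewrite (_ : Err j = fun p => sup
      [set `|v_ j z p.1 p.2 - bellman X Q K H phi (J - j) j z p.1|
      | z in [set` [set: LL]%SET]]); last by apply/funext => p; exact: ErrE.
  apply: (measurable_finite_sup (u := fun z p =>
    `|v_ j z p.1 p.2 - bellman X Q K H phi (J - j) j z p.1|)
    (A := fun=> [set: LL]%SET)) => //.
    move=> z; rewrite (_ : [set v | _] = setT)//.
    by apply/seteqP; split => // v _ /=; rewrite inE.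
  by move=> z; case: (bdiff z).
exists (CH + W + (J - j).+1%:R * CH) => p; rewrite ErrE//.
apply: norm_finite_sup => // z _; rewrite normr_id (le_trans (ler_normB _ _))// lerD//.
by have [_ vbz] := vM_bmeas W0 K0 mK mH HC CP z jJ.
Qed.

Let Nxt j (p : T * S) := \int[Q j p.1]_w Err j.+1 (X j.+1 w, p.2).

Let Err_step j p : (j < J)%N -> Err j p <= \sum_z `|tC j z p| + Nxt j p.
Proof.
move=> jJ; rewrite ErrE ?(ltnW jJ)//.
set u := fun z => `|_ - _|; have [z _ [-> _]] := finite_sup_attained u LLn0.
have JjE : (J - j)%N = (J - j.+1).+1 by rewrite subnSK.
rewrite /u {u} bellmanE /vM jJ.
apply: finite_sup_lip => [|a _]; first by apply: K0; exact: ltnW.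
set z' := phi j.+1 a z.
rewrite opprD addrACA subrr add0r.
set q := continuation _ _ _ _ _ _ _ _ _.
have cW : `|q| <= W.
  have [|_ bd] := continuation_bmeas X Q phi K0 mK mH HC
    (n := J - j) (j := j) z'.
    by rewrite subnKC// ltnW.
  rewrite (le_trans (bd _))// ler_wpM2r ?(ltW CH0)// ler_nat leq_subr //.
(* The exact continuation value is fixed by the truncation, so the error splits into the regression
   error and the difference of two truncated conditional expectations. *)
rewrite (_ : _ - q = tC j z' p + (trunc W (Ct j z' p.1 p.2) - trunc W q)); last first.
  by rewrite (trunc_id cW) /tC; ring.
rewrite (le_trans (ler_normD _ _))// lerD//.
  (* The control reached depends on the state and the samples; summing over all controls removes
     this dependence and is the origin of the factor |L|. *)
  by rewrite (bigD1 z')//= lerDl sumr_ge0.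
rewrite (le_trans (trunc_lip _ _ W0))//.
have Q1 : Q j p.1 setT = 1%E by exact: prob_kernel.
have mXs : measurable_fun setT (fun w => (X j.+1 w, p.2)) by exact: measurable_fun_pair.
have bv' := bmeas_comp (bv z' jJ) mXs.
have [|bb _] := bellman_bmeas X Q phi K0 mK mH HC
  (n := J - j.+1) (j := j.+1).
  by rewrite subnKC.
have bb' := bmeas_comp (bb z') (measurable_funPT (X j.+1)).
have -> : Ct j z' p.1 p.2 - q = \int[Q j p.1]_w (v_ j.+1 z' (X j.+1 w) p.2
    - bellman X Q K H phi (J - j.+1) j.+1 z' (X j.+1 w)).
  by rewrite (Rintegral_bmeasB Q1 bv' bb') /q JjE.
have bd := bmeasB bv' bb'.
apply: (le_trans (le_normr_Rintegral measurableT (bmeas_integrable Q1 bd))).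
apply: le_Rintegral_bmeas => //.
- case: bd => m1 [M1 h1]; split; first exact: measurableT_comp.
  by exists M1 => w; rewrite normr_id.
- exact: bmeas_comp (bErr jJ) mXs.
move=> w; rewrite ErrE//.
by apply: (le_finite_sup (fun z => `|v_ j.+1 z (X j.+1 w) p.2
  - bellman X Q K H phi (J - j.+1) j.+1 z (X j.+1 w)|)); rewrite inE.
Qed.

Let bNxt j : (j < J)%N -> bmeas (Nxt j).
Proof.
move=> jJ; apply: (bmeas_transition_param X Q j (g := fun x s => Err j.+1 (x, s))).
by rewrite (_ : (fun p => _) = Err j.+1); [exact: bErr|apply/funext => -[]].
Qed.

Let Nxt_norm j : (j < J)%N ->
  ('N[mu j \x PM]_2%:E [(fun p => (Nxt j p)%:E)] <=
   'N[mu j.+1 \x PM]_2%:E [(fun p => (Err j.+1 p)%:E)])%E.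
Proof.
move=> jJ; apply: Lnorm2_le; have bE := bErr jJ; have [mE _] := bE.
have [mN _] := bNxt jJ.
pose f p := (Nxt j p ^+ 2)%:E; pose g p := (Err j.+1 p ^+ 2)%:E.
have mf : measurable_fun setT f by exact/measurable_EFinP/measurable_funX.
have mg : measurable_fun setT g by exact/measurable_EFinP/measurable_funX.
have f0 p : (0 <= f p)%E by rewrite lee_fin sqr_ge0.
have g0 p : (0 <= g p)%E by rewrite lee_fin sqr_ge0.
rewrite (fubini_tonelli2 f)// (fubini_tonelli2 g)//.
apply: ge0_le_integral => //.
- by move=> s _; apply: integral_ge0.
- exact: measurable_fun_fubini_tonelli_G.
- exact: measurable_fun_fubini_tonelli_G.
move=> s _; rewrite /fubini_G.
have mgs : measurable_fun setT (fun x => g (x, s)).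
  by apply: measurableT_comp => //; exact: measurable_fun_pair.
have mgX : measurable_fun setT (fun w => g (X j.+1 w, s)).
  exact: (measurableT_comp mgs (measurable_funPT (X j.+1))).
(* The integral over mu_{j+1} is rewritten over mu_j by conditioning on X_j; the comparison is then
   pointwise in x. *)
rewrite [leRHS](ge0_integral_distribution X P j.+1 (h := fun x => g (x, s)))//.
rewrite (ge0_integral_conditional XM (ltnW jJ))//.
apply: ge0_le_integral => //.
- by apply: measurableT_comp => //; exact: measurable_fun_pair.
- apply: (measurable_fun_integral_kernel _ _ mgX) => // U mU.
  exact: measurable_kernel.
move=> x _; rewrite /f /g /Nxt /=.
have Q1 : Q j x setT = 1%E by exact: prob_kernel.
have bEx : bmeas (fun w => Err j.+1 (X j.+1 w, s)).
  by apply: bmeas_comp bE _; exact: measurable_fun_pair.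
(* Jensen's inequality for the square is the bias-variance identity at 0, with the variance
   dropped. *)
have := bias_variance 0 Q1 bEx; rewrite sub0r sqrrN => e.
rewrite (_ : (\int[Q j x]_w (Err j.+1 (X j.+1 w, s) ^+ 2)%:E)%E =
  (\int[Q j x]_w ((0 - Err j.+1 (X j.+1 w, s)) ^+ 2)%:E)%E); last first.
  by apply: eq_integral => w _; rewrite sub0r sqrrN.
rewrite e leeDl//; apply: integral_ge0 => w _.
by rewrite lee_fin sqr_ge0.
Qed.

Lemma error_norm j : (j <= J)%N ->
  ('N[mu j \x PM]_2%:E [(fun p => (Err j p)%:E)] <=
   (eps * (#|LL|%:R * (J - j)%:R))%:E)%E.
Proof.
move nE : (J - j)%N => n; elim: n j nE => [|n IH] j nE jJ.
  have jE : j = J by apply/eqP; rewrite eqn_leq jJ -subn_eq0 nE.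
  subst j; rewrite (_ : (fun p => _) = fun p => 0%:E); last first.
    apply/funext => p; congr (_%:E); rewrite ErrE//.
    set u := fun z => `|_ - _|; have [z _ [-> _]] := finite_sup_attained u LLn0.
    rewrite /u subnn /vM ltnn bellmanE /=.
    rewrite [X in _ - sup X](_ : _ = [set H J a z p.1 | a in [set` K J z p.1]]).
      by rewrite subrr normr0.
    by apply/seteqP; split => _ [a aK <-]; exists a => //; rewrite addr0.
  rewrite (@Lnorm2_fin _ _ _ _ (fun=> 0) 0)//.
    by rewrite sqrtr0 !mulr0.
  by rewrite integral0_eq// => p _; rewrite expr0n.
have jJ' : (j < J)%N by rewrite -subn_gt0 nE.
have nE' : (J - j.+1)%N = n by rewrite subnS nE.
have mtC z : measurable_fun setT (fun p => `|tC j z p|).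
  by apply: measurableT_comp => //; case: (btC z jJ').
have [mN _] := bNxt jJ'.
have step : ('N[mu j \x PM]_2%:E [(fun p => (Err j p)%:E)] <=
    'N[mu j \x PM]_2%:E [(fun p => (\sum_(z <- enum LL) `|tC j z p| + Nxt j p)%:E)])%E.
  apply: Lnorm2_mono.
  - by case: (bErr jJ).
  - by apply: measurable_funD => //; exact: measurable_sum.
  move=> p; have E0 : 0 <= Err j p.
    rewrite ErrE//; set u := fun z => `|_ - _|.
    by have [z _ [-> _]] := finite_sup_attained u LLn0; rewrite /u normr_ge0.
  rewrite ger0_norm// (le_trans (Err_step p jJ'))// big_enum/=; exact: ler_norm.
apply: (le_trans step).
have tCe z : ('N[mu j \x PM]_2%:E [(fun p => (`|tC j z p|)%:E)] <= eps%:E)%E.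
  apply: le_trans (estimation_norm z jJ'); apply: Lnorm2_mono => //.
    by case: (btC z jJ').
  by move=> p; rewrite normr_id.
apply: (le_trans (Lnorm2_sum (enum LL) mtC mN tCe)).
apply: (le_trans (leeD (lexx _) (le_trans (Nxt_norm jJ') (IH _ nE' jJ')))).
rewrite -EFinD lee_fin -cardE -[n.+1%:R]natr1 le_eqVlt; apply/orP; left; apply/eqP; ring.
Qed.

End error_propagation.

Theorem corollary6p3 (R : realType) :
  exists2 c : R, 0 < c &
  forall (dO d : measure_display) (Omega : measurableType dO)
    (T : measurableType d) (KK LL : finType) (J M : nat)
    (F : nat -> set (set Omega)) (X : nat -> {mfun Omega >-> T})
    (P : probability Omega R) (Q : nat -> R.-pker T ~> Omega)
    (K : nat -> LL -> T -> {set KK}) (H : nat -> KK -> LL -> T -> R)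
    (phi : nat -> KK -> LL -> LL) (CH : R)
    (Psi : nat -> set (T -> R)) (PM : probability (samples (T := T) J M) R)
    (C : nat -> LL -> T -> samples (T := T) J M -> R) (delta D : R),
  let W := J%:R * CH in
  let v_ := vM K H phi W C in
  let vstar := value J F X Q K H phi in
  let mu j := distribution P (X j) in
  (0 < M)%N ->
  markov_process J F X P Q ->
  (forall j y x, (j <= J)%N -> K j y x != finset.set0) ->
  (forall j y a, (j <= J)%N -> measurable [set x | a \in K j y x]) ->
  (forall j a y, (j <= J)%N -> measurable_fun setT (H j a y)) ->
  (forall j a y x, (j <= J)%N -> `|H j a y x| <= CH) ->
  1 <= W ->
  (forall j w, (j <= J)%N -> Psi j w -> measurable_fun setT w) ->
  is_samples_law P X PM ->
  is_empirical_projection K H phi W C Psi ->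
  0 < delta -> 0 < D ->
  (forall j, (j < J)%N ->
    (ereal_sup (range (fun z : LL => ereal_inf
       [set 'N[mu j \x PM]_2%:E
              [(fun xs => (Ctilde X Q K H phi W C j z xs.1 xs.2 - w xs.1)%:E)]
       | w in Psi j])) <= delta%:E)%E) ->
  (forall j, (j < J)%N -> (VC (Psi j) <= D%:E)%E) ->
  forall j, (j < J)%N ->
    ('N[mu j \x PM]_2%:E
       [(fun xs => (sup (range (fun z : LL =>
                     `|v_ j z xs.1 xs.2 - vstar j z xs.1|)))%:E)]
     <= ((Num.sqrt (c * W ^+ 4 * ((1 + ln M%:R) / M%:R) * D)
          + Num.sqrt 2 * delta) * geom_factor #|LL| (J - j))%:E)%E.
Proof.
exists 3360; first by lra.
move=> dO d Omega T KK LL J M F X P Q K H phi CH Psi PM C delta D W v_ vstar mu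
  M0 XM K0 mK mH HC W1 mPsi PME CP delta0 D0 bias VCD j jJ.
(* Without controls the supremum is over the empty set, where [sup] is 0, and the geometric factor
   vanishes too. *)
have [/card0_eq LL0|LLgt0] := posnP #|LL|.
  rewrite (_ : (fun xs => _) = fun=> 0%:E); last first.
    apply/funext => p; congr (_%:E); rewrite [X in sup X](_ : _ = set0) ?sup0//.
    by apply/seteqP; split=> [t [z _ _]|//]; have := LL0 z; rewrite inE.
  rewrite (eq_card0 LL0) geom_factor0 mulr0.
  rewrite (@Lnorm2_fin _ _ _ _ (fun=> 0) 0) ?sqrtr0//.
  by rewrite integral0_eq// => p _; rewrite expr0n.
have /card_gt0P[z0 _] := LLgt0.
apply: (le_trans (error_norm M0 XM K0 mK mH HC W1 mPsi PME CP delta0 D0 erefl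
  bias VCD z0 (ltnW jJ))).
rewrite lee_fin; apply: ler_wpM2l (geom_factor_ge _ _ LLgt0).
exact: addr_ge0 (sqrtr_ge0 _) (mulr_ge0 (sqrtr_ge0 _) (ltW delta0)).
Qed.
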